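(* Let $Q$ be a Dynkin quiver with vertices $1,\dots,n$, $k$ a source of $Q$, and ${\boldsymbol\nu}=(\nu^i)$ with $\nu^i\vdash d_i$. Let $\lambda=\nu^k$ and $\mu=\nu^{\mathrm{adj}(k)}$, and suppose $\lambda$ and $\mu$ are $t$-interlaced for some $t\ge0$. Suppose $V$ is a representation of $Q$ with $V\simeq\operatorname{GenRep}({\boldsymbol\nu})$ and ${\boldsymbol\nu}=\operatorname{GenJF}(V)$. Then $\operatorname{GenJF}(R^-_k(V))=\sigma_k({\boldsymbol\nu})$.
   Context: $\Bbbk$ algebraically closed; Dynkin quiver: underlying graph a simply-laced Dynkin diagram. $\operatorname{GenJF}(X)$: the tuple of Jordan types (at each vertex) of a generic nilpotent endomorphism of $X$, i.e. the value of the Jordan-type function on a dense open subset of the variety of nilpotent endomorphisms, which is the maximum in componentwise dominance order. For ${\boldsymbol\nu}\vdash\mathbf d$, fixing nilpotent operators $N_i$ of Jordan types $\nu^i$ on spaces of dimension $d_i$, the representations compatible with $N$ ($N_{t(a)}f_a=f_aN_{s(a)}$) contain a dense open subset of pairwise isomorphic representations, whose class is $\operatorname{GenRep}({\boldsymbol\nu})$. $R^-_k$ is the BGP reflection functor at the source $k$ (to $\sigma_k(Q)$; at $k$ it takes the cokernel of $V_k\to\bigoplus_{a:k\to t(a)}V_{t(a)}$). $\nu^{\mathrm{adj}(k)}$: partition whose parts are the union over arrows $a:k\to t(a)$ of the parts of $\nu^{t(a)}$. For $t\ge0$, $t$-interlaced means $\mu_1\ge\dots\ge\mu_{t+1}\ge\lambda_1\ge\mu_{t+2}\ge\mu_{t+3}\ge\lambda_2\ge\mu_{t+4}\ge\mu_{t+5}\ge\lambda_3\ge\cdots$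 (padding with zeros), and $\operatorname{diff}(\mu,\lambda)=(\mu_1,\dots,\mu_t,\mu_{t+1}+\mu_{t+2}-\lambda_1,\mu_{t+3}+\mu_{t+4}-\lambda_2,\dots)$. $\sigma_k({\boldsymbol\nu})$ equals ${\boldsymbol\nu}$ except that $\nu^k$ is replaced by $\operatorname{diff}(\nu^{\mathrm{adj}(k)},\nu^k)$. *)

(* Defs.v *)
From HB Require Import structures.
From mathcomp Require Import all_boot all_order all_algebra perm.
Set Implicit Arguments. Unset Strict Implicit. Unset Printing Implicit Defensive.
Import GRing.Theory.
Local Open Scope ring_scope.

Record quiver (n : nat) := Quiver {
  qm : nat;
  qsrc : 'I_qm -> 'I_n;
  qtgt : 'I_qm -> 'I_n }.
Arguments qm {n} q.
Arguments qsrc {n} q _.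
Arguments qtgt {n} q _.

Definition narrows n (Q : quiver n) (i j : 'I_n) : nat :=
  #|[set a : 'I_(qm Q) | ((qsrc Q a == i) && (qtgt Q a == j))
                        || ((qsrc Q a == j) && (qtgt Q a == i))]|.

Definition chain_edge (m i j : nat) : bool :=
  ((i.+1 == j) && (j < m)%N) || ((j.+1 == i) && (i < m)%N).
Definition pair_edge (x y i j : nat) : bool :=
  ((i == x) && (j == y)) || ((i == y) && (j == x)).

Definition A_edge (n : nat) (i j : nat) : bool := chain_edge n i j.
Definition D_edge (n : nat) (i j : nat) : bool :=
  chain_edge n.-1 i j || pair_edge (n - 3) n.-1 i j.
Definition E_edge (n : nat) (i j : nat) : bool :=
  chain_edge n.-1 i j || pair_edge 2 n.-1 i j.

Definition dynkin n (Q : quiver n) : Prop :=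
  exists (s : 'S_n) (e : nat -> nat -> bool),
    [/\ (0 < n)%N /\ e = A_edge n \/ (4 <= n)%N /\ e = D_edge n
        \/ n \in [:: 6; 7; 8]%N /\ e = E_edge n
      & forall i j : 'I_n, narrows Q i j = nat_of_bool (e (s i) (s j))].

Definition is_source n (Q : quiver n) (k : 'I_n) : Prop :=
  forall a : 'I_(qm Q), qtgt Q a != k.

(* ---------- Representations (row-vector convention: f_a acts x |-> x *m f_a) *)
Definition rep (F : fieldType) n (Q : quiver n) (d : 'I_n -> nat) :=
  forall a : 'I_(qm Q), 'M[F]_(d (qsrc Q a), d (qtgt Q a)).

Definition rep_iso (F : fieldType) n (Q : quiver n) (d : 'I_n -> nat)
  (X V : rep F Q d) : Prop :=
  exists P : forall i : 'I_n, 'M[F]_(d i),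
    (forall i, P i \in unitmx) /\
    forall a, X a *m P (qtgt Q a) = P (qsrc Q a) *m V a.

Definition mxpow (F : fieldType) m (A : 'M[F]_m) (e : nat) : 'M[F]_m :=
  iter e (mulmx A) 1%:M.

Definition nilp (F : fieldType) m (A : 'M[F]_m) : Prop :=
  exists e, mxpow A e = 0.

(* Partitions are encoded as functions nat -> nat (0-indexed parts, padded
   with zeros).  The Jordan type of a nilpotent A : 'M_m: its p-th largest
   block size (0-indexed p) is the number of j with
   rank A^j - rank A^(j+1) > p  (rank A^j - rank A^(j+1) = #blocks of size > j). *)
Definition jtype (F : fieldType) m (A : 'M[F]_m) (p : nat) : nat :=
  #|[set j : 'I_m | (p < \rank (mxpow A j) - \rank (mxpow A j.+1))%N]|.

Definition partition_of (la : nat -> nat) (m : nat) : Prop :=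
  [/\ forall p, (la p.+1 <= la p)%N,
      forall p, (m <= p)%N -> la p = 0%N
    & (\sum_(p < m) la p)%N = m].

Definition dominated (la mu : nat -> nat) : Prop :=
  forall q, (\sum_(p < q) la p <= \sum_(p < q) mu p)%N.

Definition nil_endo (F : fieldType) n (Q : quiver n) (d : 'I_n -> nat)
  (V : rep F Q d) (N : forall i : 'I_n, 'M[F]_(d i)) : Prop :=
  (forall i, nilp (N i)) /\
  forall a, V a *m N (qtgt Q a) = N (qsrc Q a) *m V a.

Definition isGenJF (F : fieldType) n (Q : quiver n) (d : 'I_n -> nat)
  (V : rep F Q d) (nu : 'I_n -> nat -> nat) : Prop :=
  (exists N, nil_endo V N /\ forall i p, jtype (N i) p = nu i p) /\
  (forall N, nil_endo V N -> forall i, dominated (jtype (N i)) (nu i)).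

Inductive polyfun (F : fieldType) n (Q : quiver n) (d : 'I_n -> nat) :
    (rep F Q d -> F) -> Prop :=
  | pf_const (c : F) : polyfun (fun _ => c)
  | pf_coord (a : 'I_(qm Q)) i j : polyfun (fun X => X a i j)
  | pf_add f g : polyfun f -> polyfun g -> polyfun (fun X => f X + g X)
  | pf_mul f g : polyfun f -> polyfun g -> polyfun (fun X => f X * g X).

Definition compatible (F : fieldType) n (Q : quiver n) (d : 'I_n -> nat)
  (N : forall i : 'I_n, 'M[F]_(d i)) (X : rep F Q d) : Prop :=
  forall a, X a *m N (qtgt Q a) = N (qsrc Q a) *m X a.

(* V ~= GenRep(nu): for nilpotent N_i of Jordan types nu^i, the (irreducible,
   linear) variety of N-compatible representations has a nonempty (hence dense)
   Zariski open subset -- here a basic open set {p <> 0} -- all of whose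
   members are isomorphic to V. *)
Definition isGenRep (F : fieldType) n (Q : quiver n) (d : 'I_n -> nat)
  (V : rep F Q d) (nu : 'I_n -> nat -> nat) : Prop :=
  exists N : forall i : 'I_n, 'M[F]_(d i),
    (forall i, nilp (N i) /\ forall p, jtype (N i) p = nu i p) /\
    exists f : rep F Q d -> F,
      [/\ polyfun f,
          exists X0, compatible N X0 /\ f X0 != 0
        & forall X, compatible N X -> f X != 0 -> rep_iso X V].

Definition adjpart n (Q : quiver n) (d : 'I_n -> nat)
  (nu : 'I_n -> nat -> nat) (k : 'I_n) (p : nat) : nat :=
  nth 0%N (sort geq [seq x <- flatten
        [seq [seq nu (qtgt Q a) q | q <- iota 0 (d (qtgt Q a))]
        | a <- enum 'I_(qm Q) & qsrc Q a == k] | (0 < x)%N]) p.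

Definition interlaced (t : nat) (mu la : nat -> nat) : Prop :=
  forall j, (la j <= mu (t + 2 * j))%N /\ (mu (t + 2 * j).+1 <= la j)%N.

Definition diffp (t : nat) (mu la : nat -> nat) (p : nat) : nat :=
  if (p < t)%N then mu p
  else (mu (t + 2 * (p - t)) + mu (t + 2 * (p - t)).+1 - la (p - t))%N.

Definition sigma_nu n (Q : quiver n) (d : 'I_n -> nat) (t : nat)
  (nu : 'I_n -> nat -> nat) (k : 'I_n) : 'I_n -> nat -> nat :=
  fun i => if i == k then diffp t (adjpart Q d nu k) (nu k) else nu i.

Definition outk (F : fieldType) n (Q : quiver n) (d : 'I_n -> nat)
  (V : rep F Q d) (k : 'I_n) (a : 'I_(qm Q)) : 'M[F]_(d k, d (qtgt Q a)) :=
  match @idP (qsrc Q a == k) with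
  | ReflectT h => castmx (congr1 d (eqP h), erefl) (V a)
  | ReflectF _ => 0
  end.

(* (C = F^c, (g_a)_{a : k -> t(a)}) is a cokernel of
   V_k -> (+)_{a : k -> t(a)} V_{t(a)}, x |-> (x V_a)_a, i.e.
   V_k -> (+) V_{t(a)} -> C -> 0 is exact, where (y_a) |-> sum_a y_a g_a.
   (g a for arrows not out of k is irrelevant.) *)
Definition is_cokernel (F : fieldType) n (Q : quiver n) (d : 'I_n -> nat)
  (V : rep F Q d) (k : 'I_n) (c : nat)
  (g : forall a : 'I_(qm Q), 'M[F]_(d (qtgt Q a), c)) : Prop :=
  [/\ \sum_(a | qsrc Q a == k) outk V k a *m g a = 0,
      forall z : 'rV[F]_c, exists y : forall a : 'I_(qm Q), 'rV[F]_(d (qtgt Q a)),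
        z = \sum_(a | qsrc Q a == k) y a *m g a
    & forall y : forall a : 'I_(qm Q), 'rV[F]_(d (qtgt Q a)),
        \sum_(a | qsrc Q a == k) y a *m g a = 0 ->
        exists x : 'rV[F]_(d k), forall a, qsrc Q a == k -> y a = x *m outk V k a].

(* R^-_k(V) is the representation of sigma_k(Q) with spaces V_i (i != k) and
   C = F^c at k, maps V_a for arrows a not at k, and g_a : V_{t(a)} -> C for the
   reversed arrows.  A nilpotent endomorphism of it is (Nv_i)_{i != k}, Nk: *)
Definition nil_endo_refl (F : fieldType) n (Q : quiver n) (d : 'I_n -> nat)
  (V : rep F Q d) (k : 'I_n) (c : nat)
  (g : forall a : 'I_(qm Q), 'M[F]_(d (qtgt Q a), c))
  (Nv : forall i : 'I_n, 'M[F]_(d i)) (Nk : 'M[F]_c) : Prop :=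
  [/\ forall i, i != k -> nilp (Nv i),
      nilp Nk,
      forall a, qsrc Q a != k -> V a *m Nv (qtgt Q a) = Nv (qsrc Q a) *m V a
    & forall a, qsrc Q a == k -> g a *m Nk = Nv (qtgt Q a) *m g a].

Definition jtype_refl (F : fieldType) n (d : 'I_n -> nat) (k : 'I_n) (c : nat)
  (Nv : forall i : 'I_n, 'M[F]_(d i)) (Nk : 'M[F]_c) : 'I_n -> nat -> nat :=
  fun i => if i == k then jtype Nk else jtype (Nv i).

Definition isGenJF_refl (F : fieldType) n (Q : quiver n) (d : 'I_n -> nat)
  (V : rep F Q d) (k : 'I_n) (c : nat)
  (g : forall a : 'I_(qm Q), 'M[F]_(d (qtgt Q a), c))
  (nu' : 'I_n -> nat -> nat) : Prop :=
  (exists Nv Nk, nil_endo_refl V k g Nv Nk /\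
     forall i p, jtype_refl k Nv Nk i p = nu' i p) /\
  (forall Nv Nk, nil_endo_refl V k g Nv Nk ->
     forall i, dominated (jtype_refl k Nv Nk i) (nu' i)).

(* Main.v *)
From HB Require Import structures.
From mathcomp Require Import all_boot all_order all_algebra perm zify.
From Stdlib Require Import Classical.
Require Import Defs.
Set Implicit Arguments. Unset Strict Implicit. Unset Printing Implicit Defensive.
Import GRing.Theory.
Local Open Scope ring_scope.
(** Write [W] for the sum of the [V_(t(a))] over the arrows [a] out of [k], and
    [C] for the cokernel of [V_k -> W].

    By Jordan generators there is an explicit [N]-compatible map [V_k -> W] which
    is injective and whose cokernel has Jordan type [diff(mu, la)]; by
    semicontinuity of ranks along a line, the generic compatible map, hence [V],
    is at least as good.

    Conversely [rank N_C^J + rank N_k^J <= rank N_W^J] for a nilpotent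
    endomorphism [N], and this bounds the type of [N_C] by [diff(mu, la)] as soon
    as [N_k] has type [la].  A nilpotent endomorphism [N'] of the reflected
    representation extends to [V], but its type at [k] may be smaller than [la].
    The remedy is the irreducibility of the variety of nilpotent endomorphisms of
    [V]: after conjugating a generic [N] by an automorphism of [V], all linear
    combinations of [N] and [N'] are nilpotent, and a generic one among them
    dominates [N] at [k] and [N'] on [C].  The conjugation is built along a
    composition series of [V] under its endomorphism algebra: by Burnside's
    theorem the action on each new simple factor either is determined by the
    previous ones or can be prescribed independently of them. *)

(** * Powers of a square matrix and nilpotency *)

Section MxPow.
Variable F : fieldType.

Lemma mxpowS m (A : 'M[F]_m) e : mxpow A e.+1 = A *m mxpow A e.
Proof. by []. Qed.

Lemma mxpowD m (A : 'M[F]_m) e f : mxpow A (e + f) = mxpow A e *m mxpow A f.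
Proof.
elim: e => [|e IH]; first by rewrite add0n mul1mx.
by rewrite addSn !mxpowS IH mulmxA.
Qed.

Lemma mxpow1 m (A : 'M[F]_m) : mxpow A 1 = A.
Proof. by rewrite mxpowS mulmx1. Qed.

Lemma mxpowSr m (A : 'M[F]_m) e : mxpow A e.+1 = mxpow A e *m A.
Proof. by rewrite -addn1 mxpowD mxpow1. Qed.

Lemma mxpow_intertwine m n (A : 'M[F]_m) (B : 'M[F]_n) (X : 'M[F]_(m, n)) e :
  X *m B = A *m X -> X *m mxpow B e = mxpow A e *m X.
Proof.
move=> XB; elim: e => [|e IH]; first by rewrite mulmx1 mul1mx.
by rewrite !mxpowS mulmxA XB -mulmxA IH mulmxA.
Qed.

Lemma mxpow_eq0W m (A : 'M[F]_m) e f : (e <= f)%N -> mxpow A e = 0 -> mxpow A f = 0.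
Proof. by move=> /subnK <- A0; rewrite mxpowD A0 mulmx0. Qed.

Lemma nilp_row_free m n (A : 'M[F]_m) (B : 'M[F]_n) (X : 'M[F]_(m, n)) :
  row_free X -> X *m B = A *m X -> nilp B -> nilp A.
Proof.
move=> Xf XB [e Be]; exists e; apply: (row_free_inj Xf).
by rewrite -(mxpow_intertwine e XB) Be mulmx0 mul0mx.
Qed.

Lemma nilp_row_full m n (A : 'M[F]_m) (B : 'M[F]_n) (X : 'M[F]_(m, n)) :
  row_full X -> X *m B = A *m X -> nilp A -> nilp B.
Proof.
move=> Xf XB [e Ae]; exists e; apply: (row_full_inj Xf).
by rewrite (mxpow_intertwine e XB) Ae mulmx0 mul0mx.
Qed.

Lemma mxrank_mxpow_conj m (A B P : 'M[F]_m) e :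
  P \in unitmx -> P *m B = A *m P -> \rank (mxpow A e) = \rank (mxpow B e).
Proof.
move=> Pu PB; rewrite -(mxrankMfree (mxpow A e) (B := P)) ?row_free_unit //.
by rewrite -(mxpow_intertwine e PB) eqmxMfull // row_full_unit.
Qed.

Lemma mxrank_mxpowS m (A : 'M[F]_m) j :
  (\rank (mxpow A j.+1) <= \rank (mxpow A j))%N.
Proof. by rewrite mxpowS mxrankM_maxr. Qed.

(** Frobenius' rank inequality for the product [A], [mxpow A h], [A], iterated. *)
Lemma mxrank_drop_mono m (A : 'M[F]_m) i j : (i <= j)%N ->
  (\rank (mxpow A j) - \rank (mxpow A j.+1)
     <= \rank (mxpow A i) - \rank (mxpow A i.+1))%N.
Proof.
move=> /subnK <-; elim: (j - i)%N => [|l IH]; first by rewrite add0n.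
apply: leq_trans IH; rewrite addSn; set h := (l + i)%N.
have := mxrank_Frobenius A (mxpow A h) A.
rewrite -mxpowS -mxpowSr -mxpowSr.
have := mxrank_mxpowS A h; have := mxrank_mxpowS A h.+1; lia.
Qed.

(** The ranks of successive powers drop strictly until they stabilise, and nilpotency makes the
    stable value zero. *)
Lemma nilp_mxpow_size m (A : 'M[F]_m) e : nilp A -> (m <= e)%N -> mxpow A e = 0.
Proof.
move=> [f Af] /mxpow_eq0W; apply; apply/eqP; rewrite -mxrank_eq0.
have key j : (\rank (mxpow A j) = 0 \/ \rank (mxpow A j) + j <= m)%N.
  elim: j => [|j IH]; first by right; rewrite addn0 rank_leq_row.
  have lej := mxrank_mxpowS A j.
  case: IH => IH; first by left; lia.
  case: (ltnP (\rank (mxpow A j.+1)) (\rank (mxpow A j))) => [|ge]; first lia.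
  left; have cst l : \rank (mxpow A (l + j.+1)) = \rank (mxpow A j.+1).
    elim: l => [|l IHl]; first by rewrite add0n.
    rewrite addSn; have := mxrank_mxpowS A (l + j.+1).
    have := @mxrank_drop_mono _ A j (l + j.+1) ltac:(lia); lia.
  by rewrite -(cst f) mxpowD Af mul0mx mxrank0.
by case: (key m) => H; apply/eqP; lia.
Qed.

End MxPow.

(** * Partitions and ranks of powers *)

Section Partitions.

(* For a partition [la] that vanishes from [M] on, the sum of the first [q] parts
   is the minimum over [J] of [J * q + excess M la J], and [excess M (jtype A) J]
   is the rank of [A ^ J]; dominance is thus a comparison of ranks of powers. *)
Definition excess (M : nat) (la : nat -> nat) (J : nat) : nat :=
  (\sum_(p < M) (la p - J))%N.

Lemma excess_widen M M' la J : (forall p, M <= p -> la p = 0)%N -> (M <= M')%N ->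
  excess M' la J = excess M la J.
Proof.
move=> la0 /subnKC <-; rewrite /excess big_split_ord /=.
rewrite [X in (_ + X)%N]big1 ?addn0 // => i _.
by rewrite la0 ?sub0n ?leq_addr.
Qed.

Lemma sum_widen M M' la : (forall p, M <= p -> la p = 0)%N -> (M <= M')%N ->
  (\sum_(p < M') la p = \sum_(p < M) la p)%N.
Proof.
move=> la0 /subnKC <-; rewrite big_split_ord /=.
by rewrite [X in (_ + X)%N]big1 ?addn0 // => i _; rewrite la0 ?leq_addr.
Qed.

Lemma partial_sum_le M la J q : (forall p, M <= p -> la p = 0)%N ->
  (\sum_(p < q) la p <= J * q + excess M la J)%N.
Proof.
move=> la0; apply: leq_trans (_ : _ <= \sum_(p < q) (J + (la p - J)))%N _.
  by apply: leq_sum => i _; lia.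
rewrite big_split /= sum_nat_const card_ord mulnC leq_add2l.
case: (leqP q M) => qM.
  rewrite /excess -(subnKC qM) big_split_ord /=; exact: leq_addr.
by rewrite -/(excess q la J) (excess_widen J la0 (ltnW qM)).
Qed.

Lemma nonincr_le la p q : (forall p, la p.+1 <= la p)%N -> (p <= q)%N -> (la q <= la p)%N.
Proof.
move=> mono /subnK <-; elim: (q - p)%N => [|l IH] //.
by rewrite addSn; apply: leq_trans IH.
Qed.

Lemma partial_sum_eq M la q : (forall p, la p.+1 <= la p)%N ->
  (forall p, M <= p -> la p = 0)%N ->
  (\sum_(p < q) la p = la q * q + excess M la (la q))%N.
Proof.
move=> mono la0; rewrite -(excess_widen _ la0 (leq_maxl M q)).
have /subnKC <- := leq_maxr M q; rewrite /excess big_split_ord /=.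
rewrite [X in (_ + (_ + X))%N]big1 ?addn0; last first.
  by move=> i _; apply/eqP; rewrite subn_eq0 (nonincr_le mono) ?leq_addr.
have -> : (la q * q = \sum_(p < q) la q)%N by rewrite sum_nat_const card_ord mulnC.
rewrite -big_split /=; apply: eq_bigr => i _.
by rewrite subnKC // (nonincr_le mono) // ltnW.
Qed.

(** The witness [q] is the number of parts larger than [J]: exactly these parts contribute to the
    excess. *)
Lemma excess_eq M la J : (forall p, la p.+1 <= la p)%N ->
  (forall p, M <= p -> la p = 0)%N ->
  exists q, (\sum_(p < q) la p = J * q + excess M la J)%N.
Proof.
move=> mono la0.
have : exists q, (la q <= J)%N by exists M; rewrite la0.
move=> /ex_minnP[q laq qmin]; exists q.
rewrite -(excess_widen _ la0 (leq_maxl M q)).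
have /subnKC <- := leq_maxr M q; rewrite /excess big_split_ord /=.
rewrite [X in (_ + (_ + X))%N]big1 ?addn0; last first.
  move=> i _; apply/eqP; rewrite subn_eq0; apply: leq_trans laq.
  by rewrite (nonincr_le mono) ?leq_addr.
have -> : (J * q = \sum_(p < q) J)%N by rewrite sum_nat_const card_ord mulnC.
rewrite -big_split /=; apply: eq_bigr => i _.
rewrite subnKC //; case: (leqP J (la i)) => // /ltnW /qmin.
by rewrite leqNgt ltn_ord.
Qed.

Lemma dominated_excess M ka la J : (forall p, ka p.+1 <= ka p)%N ->
  (forall p, M <= p -> ka p = 0)%N -> (forall p, M <= p -> la p = 0)%N ->
  dominated ka la -> (excess M ka J <= excess M la J)%N.
Proof.
move=> monok k0 l0 dom; have [q Hq] := excess_eq J monok k0.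
have := partial_sum_le J q l0; have := dom q; lia.
Qed.

Lemma excess_dominated M ka la : (forall p, la p.+1 <= la p)%N ->
  (forall p, M <= p -> ka p = 0)%N -> (forall p, M <= p -> la p = 0)%N ->
  (forall J, excess M ka J <= excess M la J)%N -> dominated ka la.
Proof.
move=> monol k0 l0 le q; rewrite (partial_sum_eq q monol l0).
by apply: leq_trans (partial_sum_le (la q) q k0) _; rewrite leq_add2l.
Qed.

Lemma dominated_anti ka la : dominated ka la -> dominated la ka -> ka =1 la.
Proof.
move=> kl lk p; have := kl p.+1; have := lk p.+1; have := kl p; have := lk p.
rewrite !big_ord_recr /=; lia.
Qed.

(** * The partition [diff(mu, la)] of an interlaced pair *)

Section Diff.
Variables (t : nat) (mu la : nat -> nat).
Hypotheses (mu_mono : forall p, (mu p.+1 <= mu p)%N) (inter : interlaced t mu la).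

Lemma diffp_head q : (q <= t)%N -> (\sum_(p < q) diffp t mu la p = \sum_(p < q) mu p)%N.
Proof.
by move=> qt; apply: eq_bigr => i _; rewrite /diffp (leq_trans (ltn_ord i) qt).
Qed.

Lemma diffp_addn s :
  diffp t mu la (t + s) = (mu (t + 2 * s) + mu (t + 2 * s).+1 - la s)%N.
Proof. by rewrite /diffp ltnNge leq_addr /= addKn. Qed.

(** Interlacing keeps the truncated subtraction in [diffp] exact, so that each new part uses up two
    parts of [mu] and one of [la]. *)
Lemma diffp_sum s :
  (\sum_(p < t + s) diffp t mu la p + \sum_(p < s) la p = \sum_(p < t + 2 * s) mu p)%N.
Proof.
elim: s => [|s IH]; first by rewrite big_ord0 muln0 !addn0 diffp_head.
have -> : (t + 2 * s.+1 = (t + 2 * s).+2)%N by lia.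
rewrite addnS !big_ord_recr /= diffp_addn -IH.
have [] := inter s; move: (\sum_(i < t + s) _)%N (\sum_(i < s) _)%N => a b; lia.
Qed.

Lemma diffp_mono p : (diffp t mu la p.+1 <= diffp t mu la p)%N.
Proof.
case: (ltnP p t) => pt.
  rewrite {2}/diffp pt; case: (ltnP p.+1 t) => pt1; first by rewrite /diffp pt1.
  have -> : p.+1 = (t + 0)%N by lia.
  have := inter 0%N; rewrite diffp_addn muln0 addn0 => -[].
  have := nonincr_le mu_mono (leqnSn p); have -> : p.+1 = t by lia.
  lia.
rewrite -(subnKC pt) -addnS !diffp_addn.
have := inter (p - t)%N; have := inter (p - t)%N.+1.
have := mu_mono (t + 2 * (p - t)).+1.
have -> : (t + 2 * (p - t).+1 = (t + 2 * (p - t)).+2)%N by lia.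
lia.
Qed.

Lemma diffp_tail M p : (forall p, M <= p -> mu p = 0)%N -> (t + M <= p)%N ->
  diffp t mu la p = 0%N.
Proof.
move=> mu0 Mp; have tp : (t <= p)%N by lia.
by rewrite -(subnKC tp) diffp_addn !mu0 //; lia.
Qed.

Lemma interlaced_tail M j : (forall p, M <= p -> mu p = 0)%N -> (M <= j)%N -> la j = 0%N.
Proof. by move=> mu0 Mj; have [] := inter j; rewrite mu0; lia. Qed.

(** With [J = mu q], or [J = mu (t + 2 * s)] for [q = t + s], the bound on the partial sums of [mu]
    is an equality, while the bounds for [ka] and [la] hold at every [J]. *)
Lemma dominated_diffp M ka :
  (forall p, M <= p -> mu p = 0)%N -> (forall p, M <= p -> ka p = 0)%N ->
  (forall J, excess M ka J + excess M la J <= excess M mu J)%N ->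
  dominated ka (diffp t mu la).
Proof.
move=> mu0 ka0 le q; have la0 j := interlaced_tail (j := j) mu0.
case: (leqP q t) => qt.
  rewrite diffp_head // (partial_sum_eq q mu_mono mu0).
  apply: leq_trans (partial_sum_le (mu q) q ka0) _.
  by have := le (mu q); lia.
rewrite -(subnKC (ltnW qt)); set s := (q - t)%N.
have := diffp_sum s; set J := mu (t + 2 * s)%N.
have := partial_sum_eq (t + 2 * s)%N mu_mono mu0; rewrite -/J.
have := partial_sum_le J (t + s)%N ka0; have := partial_sum_le J s la0.
have := le J; nia.
Qed.

End Diff.

(** A set closed downwards is an initial segment: lowering its size by [J] amounts to discarding the
    indices below [J]. *)
Lemma subn_sum_downset (b : nat -> bool) m J :
  (forall i j, (i <= j)%N -> b j -> b i) ->
  (\sum_(j < m) b j - J = \sum_(J <= j < m) b j)%N.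
Proof.
move=> down; case: (leqP m J) => mJ.
  rewrite [RHS]big_geq //; apply/eqP; rewrite subn_eq0.
  apply: leq_trans mJ; rewrite -[X in (_ <= X)%N]card_ord -sum1_card.
  by apply: leq_sum => i _; case: (b i).
rewrite -(big_mkord xpredT (fun j => b j : nat)) (big_cat_nat (n := J)) ?(ltnW mJ) //=.
case bJ : (b J).
  rewrite [X in (X + _ - _)%N](_ : _ = J) ?addKn //.
  rewrite big_nat_cond (eq_bigr (fun=> 1%N)).
    by rewrite -big_nat_cond sum_nat_const_nat subn0 muln1.
  by move=> i /andP[/andP[_ iJ] _]; rewrite (down _ _ (ltnW iJ) bJ).
rewrite [X in (_ + X - _ = X)%N](_ : _ = 0)%N; last first.
  rewrite big_nat_cond big1 // => i /andP[/andP[Ji _] _].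
  by case bi : (b i) => //; rewrite (down _ _ Ji bi) in bJ.
apply/eqP; rewrite addn0 subn_eq0 -[X in (_ <= X)%N]subn0 -[X in (_ <= X)%N]muln1.
by rewrite -sum_nat_const_nat; apply: leq_sum => i _; case: (b i).
Qed.

End Partitions.

(** * Jordan types in terms of ranks of powers *)

Section JType.
Variable F : fieldType.

Lemma jtypeE m (A : 'M[F]_m) p : (jtype A p =
  \sum_(j < m) (p < \rank (mxpow A j) - \rank (mxpow A j.+1)))%N.
Proof.
rewrite /jtype -sum1dep_card big_mkcond /=; apply: eq_bigr => i _.
by case: (_ < _)%N.
Qed.

Lemma jtype_mono m (A : 'M[F]_m) p : (jtype A p.+1 <= jtype A p)%N.
Proof. by rewrite !jtypeE; apply: leq_sum => i _; lia. Qed.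

Lemma jtype_tail m (A : 'M[F]_m) p : (m <= p)%N -> jtype A p = 0%N.
Proof.
move=> mp; rewrite jtypeE big1 // => i _.
have := rank_leq_row (mxpow A i); lia.
Qed.

(** The indices counted by [jtype] form an initial segment, so the part is at most [j] exactly when
    [j] is not among them. *)
Lemma jtype_le m (A : 'M[F]_m) j p : (j < m)%N ->
  (jtype A p <= j)%N = (\rank (mxpow A j) - \rank (mxpow A j.+1) <= p)%N.
Proof.
move=> jm; rewrite -subn_eq0 jtypeE.
rewrite (subn_sum_downset
  (b := fun j => (p < \rank (mxpow A j) - \rank (mxpow A j.+1))%N)); last first.
  by move=> a b ab; have := mxrank_drop_mono A ab; lia.
rewrite big_ltn // addn_eq0 eqb0 -leqNgt; case: leqP => //= le.
apply/eqP; rewrite big_nat_cond big1 // => i /andP[/andP[ji _] _].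
apply/eqP; rewrite eqb0 -leqNgt; apply: leq_trans le.
exact: mxrank_drop_mono (ltnW ji).
Qed.

Lemma telescope_nonincr (r : nat -> nat) J m : (forall j, r j.+1 <= r j)%N ->
  (J <= m)%N -> (\sum_(J <= j < m) (r j - r j.+1) + r m = r J)%N.
Proof.
move=> mono /subnKC <-; elim: (m - J)%N => [|l IH]; first by rewrite addn0 big_geq.
rewrite addnS big_nat_recr ?leq_addr //=.
by move: IH (mono (J + l)%N); move: (\sum_(J <= i < J + l) _)%N => a; lia.
Qed.

Lemma sum_ltn_nat M x : (x <= M)%N -> (\sum_(p < M) (p < x) = x)%N.
Proof.
move=> xM; rewrite -[RHS]card_ord -sum1_card -[in LHS](subnKC xM) big_split_ord /=.
rewrite [X in (_ + X)%N]big1 ?addn0; last by move=> i _; lia.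
by apply: eq_bigr => i _; rewrite ltn_ord.
Qed.

(** The boxes of the Young diagram in the columns of index at least [J] are counted by columns
    instead of rows; the column lengths are the drops of rank, and they telescope. *)
Lemma excess_jtype m (A : 'M[F]_m) M J : nilp A -> (m <= M)%N ->
  excess M (jtype A) J = \rank (mxpow A J).
Proof.
move=> nA mM; rewrite /excess.
have sub_jtype p : (jtype A p - J =
    \sum_(J <= j < m) (p < \rank (mxpow A j) - \rank (mxpow A j.+1)))%N.
  rewrite jtypeE.
  rewrite (subn_sum_downset
    (b := fun j => (p < \rank (mxpow A j) - \rank (mxpow A j.+1))%N)) //.
  by move=> a b ab; have := mxrank_drop_mono A ab; lia.
rewrite (eq_bigr _ (fun (p : 'I_M) _ => sub_jtype p)).
rewrite exchange_big /=; case: (leqP J m) => Jm; last first.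
  by rewrite big_geq ?(ltnW Jm) // nilp_mxpow_size ?mxrank0 // ltnW.
rewrite (eq_bigr (fun j => (\rank (mxpow A j) - \rank (mxpow A j.+1))%N)).
  have := telescope_nonincr (mxrank_mxpowS A) Jm.
  by rewrite (nilp_mxpow_size nA (leqnn m)) mxrank0 addn0.
move=> j _; apply: sum_ltn_nat; apply: leq_trans mM.
by have := rank_leq_row (mxpow A j); lia.
Qed.

End JType.
(** * Generic points of a line *)

Section Generic.
Variable F : closedFieldType.

Definition polyc (f : F -> F) : Prop := exists p : {poly F}, forall s, f s = p.[s].

Definition polymx m n (f : F -> 'M[F]_(m, n)) : Prop :=
  forall i j, polyc (fun s => f s i j).

(** Thus [P] holds outside a finite set of parameters, namely the roots of [p]. *)
Definition generic (P : F -> Prop) : Prop :=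
  exists p : {poly F}, p != 0 /\ forall s, p.[s] != 0 -> P s.

Lemma polyc_const c : polyc (fun=> c).
Proof. by exists c%:P => s; rewrite hornerC. Qed.

Lemma polyc_add f g : polyc f -> polyc g -> polyc (fun s => f s + g s).
Proof. by move=> [p fp] [q gq]; exists (p + q) => s; rewrite hornerD fp gq. Qed.

Lemma polyc_mul f g : polyc f -> polyc g -> polyc (fun s => f s * g s).
Proof. by move=> [p fp] [q gq]; exists (p * q) => s; rewrite hornerM fp gq. Qed.

Lemma polyc_ext f g : f =1 g -> polyc f -> polyc g.
Proof. by move=> fg [p fp]; exists p => s; rewrite -fg. Qed.

Lemma polyc_sum (I : Type) (r : seq I) (P : pred I) (f : I -> F -> F) :
  (forall i, polyc (f i)) -> polyc (fun s => \sum_(i <- r | P i) f i s).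
Proof.
move=> fP; elim: r => [|i r IH].
  by apply: polyc_ext (polyc_const 0) => s; rewrite big_nil.
case Pi : (P i); last by apply: polyc_ext IH => s; rewrite big_cons Pi.
by apply: polyc_ext (polyc_add (fP i) IH) => s; rewrite big_cons Pi.
Qed.

Lemma polyc_prod (I : Type) (r : seq I) (P : pred I) (f : I -> F -> F) :
  (forall i, polyc (f i)) -> polyc (fun s => \prod_(i <- r | P i) f i s).
Proof.
move=> fP; elim: r => [|i r IH].
  by apply: polyc_ext (polyc_const 1) => s; rewrite big_nil.
case Pi : (P i); last by apply: polyc_ext IH => s; rewrite big_cons Pi.
by apply: polyc_ext (polyc_mul (fP i) IH) => s; rewrite big_cons Pi.
Qed.

Lemma polymx_const m n (A : 'M[F]_(m, n)) : polymx (fun=> A).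
Proof. by move=> i j; apply: polyc_const. Qed.

Lemma polymx_mul m n p (f : F -> 'M[F]_(m, n)) (g : F -> 'M[F]_(n, p)) :
  polymx f -> polymx g -> polymx (fun s => f s *m g s).
Proof.
move=> fP gP i j.
apply: polyc_ext (fun s => \sum_l f s i l * g s l j) _ _ _ => [s|].
  by rewrite mxE.
by apply: polyc_sum => l; apply: polyc_mul.
Qed.

Lemma polymx_line m n (A B : 'M[F]_(m, n)) : polymx (fun s => (1 - s) *: A + s *: B).
Proof.
move=> i j; exists ((1 - 'X) * (A i j)%:P + 'X * (B i j)%:P) => s.
by rewrite !mxE !hornerE.
Qed.

Lemma polymx_pow m (f : F -> 'M[F]_m) e : polymx f -> polymx (fun s => mxpow (f s) e).
Proof.
move=> fP; elim: e => [|e IH]; first exact: polymx_const.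
exact: polymx_mul.
Qed.

Lemma polymx_col m1 m2 n (f : F -> 'M[F]_(m1, n)) (g : F -> 'M[F]_(m2, n)) :
  polymx f -> polymx g -> polymx (fun s => col_mx (f s) (g s)).
Proof.
move=> fP gP i j; rewrite -(splitK i); case: (split i) => l /=.
  by apply: polyc_ext (fP l j) => s; rewrite col_mxEu.
by apply: polyc_ext (gP l j) => s; rewrite col_mxEd.
Qed.

Lemma polymx_det m (f : F -> 'M[F]_m) : polymx f -> polyc (fun s => \det (f s)).
Proof.
move=> fP; apply: polyc_sum => s; apply: polyc_mul; first exact: polyc_const.
by apply: polyc_prod => i; apply: fP.
Qed.

(** A nonconstant [p] takes the value one, at a root of [p - 1]. *)
Lemma generic_ex P : generic P -> exists s, P s.
Proof.
move=> [p [p0 pP]]; suff [s ps] : exists s, p.[s] != 0 by exists s; apply: pP.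
case: (boolP (size p == 1)%N) => [/size_poly1P[c c0 ->]|sp].
  by exists 0; rewrite hornerC.
have : size (p - 1%:P) != 1%N.
  have sp2 : (1 < size p)%N by move: p0 sp; rewrite -size_poly_eq0; lia.
  by rewrite size_polyDl // size_polyN size_polyC oner_neq0.
move=> /closed_rootP[s]; rewrite rootE !hornerE subr_eq0 => /eqP ps.
by exists s; rewrite ps oner_neq0.
Qed.

Lemma generic_and P R : generic P -> generic R -> generic (fun s => P s /\ R s).
Proof.
move=> [p [p0 pP]] [q [q0 qR]]; exists (p * q); split.
  by rewrite mulf_neq0.
by move=> s; rewrite hornerM mulf_eq0 negb_or => /andP[/pP ? /qR].
Qed.

Lemma generic_all m (P : 'I_m -> F -> Prop) :
  (forall i, generic (P i)) -> generic (fun s => forall i, P i s).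
Proof.
elim: m P => [|m IH] P gP.
  by exists 1; split=> [|s _ []//]; rewrite oner_neq0.
have [p [p0 pP]] := generic_and (gP ord0) (IH _ (fun i => gP (lift ord0 i))).
exists p; split=> // s /pP[P0 PS] i.
by case: (unliftP ord0 i) => [j|] ->.
Qed.

Lemma generic_polyc f s0 : polyc f -> f s0 != 0 -> generic (fun s => f s != 0).
Proof.
move=> [p fp] fs0; exists p; split=> [|s]; last by rewrite fp.
by apply: contra_neq fs0 => p0; rewrite fp p0 horner0.
Qed.

(** One-sided inverses of the two factors of a rank factorisation of [f s0] give a determinant that
    is polynomial in [s] and equals one at [s0]; wherever it is nonzero the rank has not dropped. *)
Lemma generic_rank m n (f : F -> 'M[F]_(m, n)) s0 :
  polymx f -> generic (fun s => \rank (f s0) <= \rank (f s))%N.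
Proof.
move=> fP; set L := pinvmx (col_base (f s0)); set R := pinvmx (row_base (f s0)).
have dP : polyc (fun s => \det (L *m f s *m R)).
  by apply: polymx_det; do 2?apply: polymx_mul => //; apply: polymx_const.
have d0 : \det (L *m f s0 *m R) != 0.
  rewrite -[X in L *m X](mulmx_base (f s0)) mulmxA mulVpmx ?col_base_full // mul1mx.
  by rewrite mulmxVp ?row_base_free // det1 oner_neq0.
have [p [p0 pP]] := generic_polyc dP d0; exists p; split=> // s /pP.
rewrite -unitfE -unitmxE -row_free_unit => /eqnP <-.
by apply: leq_trans (mxrankM_maxl _ _) (mxrankM_maxr _ _).
Qed.

End Generic.
(** * Jordan generators of a nilpotent matrix *)

Section JordanGenerators.
Variable F : fieldType.

(* The [v p] generate ['rV_m] as a module over [F[A]]. *)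
Definition generates m (A : 'M[F]_m) (v : nat -> 'rV[F]_m) : Prop :=
  forall U : 'M[F]_m, (forall p i, (v p *m mxpow A i <= U)%MS) -> row_full U.

(** [row_base A *m col_base A] is the matrix of [A] restricted to its image, in the basis
    [row_base A]. *)
Lemma mxrank_mxpow_restrict m (A : 'M[F]_m) j :
  \rank (mxpow (row_base A *m col_base A) j) = \rank (mxpow A j.+1).
Proof.
have RA : row_base A *m A = (row_base A *m col_base A) *m row_base A.
  by rewrite -[X in _ *m X = _](mulmx_base A) mulmxA.
rewrite mxpowS -[X in _ = \rank (X *m _)](mulmx_base A) -mulmxA (mxpow_intertwine j RA) mulmxA.
by rewrite mxrankMfree ?row_base_free // eqmxMfull ?col_base_full.
Qed.

(* Lift the generators of [A] restricted to its image, then add vectors of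
   [ker A] to complete the span. *)
Lemma jordan_generators m (A : 'M[F]_m) : nilp A ->
  exists v : nat -> 'rV[F]_m,
    (forall p j, (\rank (mxpow A j) - \rank (mxpow A j.+1) <= p)%N ->
       v p *m mxpow A j = 0) /\ generates A v.
Proof.
elim/ltn_ind: m A => m IHm A nA.
case: (posnP m) => [m0|m_gt0].
  move: A nA; rewrite m0 => A _; exists (fun=> 0); split=> [p j _|U _].
    by rewrite mul0mx.
  by rewrite /row_full; have := rank_leq_row U; lia.
set r := \rank A; set B := row_base A; set A' := B *m col_base A.
have BA : B *m A = A' *m B by rewrite -[X in _ *m X = _](mulmx_base A) mulmxA.
have rk' := mxrank_mxpow_restrict A; rewrite -/B -/A' in rk'.
have r_lt : (r < m)%N.
  rewrite ltn_neqAle rank_leq_row andbT; apply/negP => /eqP rm.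
  have Af : row_free A by apply/eqP.
  have [e Ae] := nA.
  have rke : \rank (mxpow A e) = m.
    elim: e {Ae} => [|e IH]; first by rewrite mxrank1.
    by rewrite mxpowSr mxrankMfree.
  by move: rke; rewrite Ae mxrank0; lia.
have nA' : nilp A' by apply: (nilp_row_free (row_base_free A) BA).
have [v' [v'0 v'gen]] := IHm r r_lt A' nA'.
(* [w p] is a preimage under [A] of the generator with coordinates [v' p] in the image. *)
pose w p := v' p *m pinvmx (col_base A).
have wA p : w p *m A = v' p *m B.
  rewrite -[X in _ *m X = _](mulmx_base A) /w mulmxA -(mulmxA (v' p)).
  by rewrite mulVpmx ?col_base_full // mulmx1.
(* [d1] is the number of Jordan blocks of [A'], so [v' p] vanishes for [d1 <= p]. *)
pose d1 := (\rank (mxpow A 1) - \rank (mxpow A 2))%N.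
have im_sub (U : 'M[F]_m) :
    (forall p i, (p < d1)%N -> (w p *m mxpow A i.+1 <= U)%MS) -> (A <= U)%MS.
  move=> wU; rewrite -(eq_row_base A) -/B submxE; apply/eqP.
  have /v'gen : forall p i, (v' p *m mxpow A' i <= kermx (B *m cokermx U))%MS.
    move=> p i; apply/sub_kermxP; rewrite mulmxA -(mulmxA (v' p)).
    rewrite -(mxpow_intertwine i BA) (mulmxA (v' p) B).
    case: (ltnP p d1) => pd; last first.
      have := v'0 p 0%N; rewrite !rk' mulmx1 => -> //.
      by rewrite !mul0mx.
    by apply/eqP; rewrite -wA -(mulmxA (w p)) -submxE; apply: wU.
  by rewrite -sub1mx => /sub_kermxP; rewrite mul1mx.
pose U0 := (\sum_(p < d1) \sum_(i < m) <<w p *m mxpow A i>>)%MS.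
have wU0 p i : (p < d1)%N -> (w p *m mxpow A i <= U0)%MS.
  move=> pd; case: (ltnP i m) => im; last by rewrite nilp_mxpow_size // mulmx0 sub0mx.
  apply: (sumsmx_sup (Ordinal pd)) => //; apply: (sumsmx_sup (Ordinal im)) => //.
  by rewrite genmxE.
have AU0 : (A <= U0)%MS by apply: im_sub => p i; apply: wU0.
have AU0A : (A <= U0 *m A)%MS.
  apply: submx_trans (im_sub <<U0 *m A>>%MS _) _; rewrite ?genmxE // => p i pd.
  by rewrite genmxE mxpowSr mulmxA submxMr ?wU0.
(* [K] completes the part of [ker A] inside [U0] to all of [ker A]. Its rank is at most the number
   of blocks of size one, so its basis vectors fit the indices from [d1] on. *)
pose K := (kermx A :\: U0)%MS.
have rkK : (\rank K <= \rank (mxpow A 0) - \rank (mxpow A 1) - d1)%N.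
  have := mxrank_cap_compl (kermx A) U0; rewrite mxrank_ker -/K.
  have : (\rank (A :&: kermx A) <= \rank (kermx A :&: U0))%N.
    by apply: mxrankS; rewrite sub_capmx capmxSr (submx_trans (capmxSl _ _) AU0).
  have := mxrank_mul_ker A A; rewrite /d1 !mxpowS mulmx1 mxrank1 -/r; lia.
pose v p := if (p < d1)%N then w p else
  if insub (p - d1)%N is Some i then row (i : 'I_(\rank K)) (row_base K) else 0.
exists v; split.
  move=> p j; rewrite /v; case: (ltnP p d1) => pd.
    case: j => [|j] pj.
      have := @mxrank_drop_mono _ _ A 0 1 isT; rewrite -/d1; lia.
    rewrite mxpowS mulmxA wA -mulmxA (mxpow_intertwine j BA) mulmxA v'0 ?mul0mx //.
    by rewrite !rk'.
  case: insubP => [i im iE|_ _]; last by rewrite mul0mx.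
  case: j => [|j] pj; first by move: im rkK pj; lia.
  have /sub_kermxP rA : (row i (row_base K) <= kermx A)%MS.
    by rewrite (submx_trans (row_sub _ _)) // eq_row_base diffmxSl.
  by rewrite mxpowS mulmxA rA mul0mx.
move=> U vU; have U0U : (U0 <= U)%MS.
  apply/sumsmx_subP => p _; apply/sumsmx_subP => i _; rewrite genmxE.
  by have := vU p i; rewrite /v ltn_ord.
have KU : (K <= U)%MS.
  rewrite -(eq_row_base K); apply/row_subP => i.
  have := vU (d1 + i)%N 0%N; rewrite /v ltnNge leq_addr /= addKn mulmx1.
  by rewrite insubT // => im; rewrite (_ : Sub _ _ = i) //; apply: val_inj.
have kerU : (kermx A <= U)%MS.
  rewrite -(addsmx_diff_cap_eq _ U0) addsmx_sub KU.
  exact: submx_trans (capmxSr _ _) U0U.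
(* Since [A] already maps [U0] onto its image, every vector lies in [ker A] modulo [U0]. *)
have [Y AY] := submxP AU0A.
have /submx_trans : (1%:M - Y *m U0 <= kermx A)%MS.
  by apply/sub_kermxP; rewrite mulmxBl mul1mx -mulmxA -AY subrr.
move=> /(_ _ _ kerU) H; rewrite -sub1mx -(subrK (Y *m U0) 1%:M).
by rewrite addmx_sub // mulmx_sub.
Qed.

End JordanGenerators.
(** * Conjugacy of nilpotent elements in a matrix algebra *)

Section LinearSets.
Variable F : fieldType.

(** By excluded middle, a vector of [X] outside the current span is adjoined as long as there is
    one; the dimension bounds the number of rounds. *)
Lemma linear_set_submx n (X : 'rV[F]_n -> Prop) :
  X 0 -> (forall a x y, X x -> X y -> X (a *: x + y)) ->
  exists U : 'M[F]_n, forall x, X x <-> (x <= U)%MS.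
Proof.
move=> X0 Xlin.
have Xsum m (c : 'rV[F]_m) (B : 'M[F]_(m, n)) :
    (forall i, X (row i B)) -> X (c *m B).
  move=> XB; rewrite mulmx_sum_row; elim/big_ind: _ => // [x y Xx Xy|i _].
    by rewrite -[x]scale1r; apply: Xlin.
  by rewrite -[_ *: _]addr0; apply: Xlin.
suff key l m (B : 'M[F]_(m, n)) : (n - \rank B <= l)%N -> (forall i, X (row i B)) ->
    exists U : 'M[F]_n, forall x, X x <-> (x <= U)%MS.
  by apply: (key _ _ (0 : 'M_n) (leqnn _)) => i; rewrite row0.
elim: l m B => [|l IH] m B rB XB.
  exists <<B>>%MS => x; split=> [_|]; rewrite genmxE.
    by apply: submx_full; rewrite /row_full; have := rank_leq_col B; lia.
  by move=> /submxP[c ->]; apply: Xsum.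
case: (classic (exists x, X x /\ ~~ (x <= B)%MS)) => [[x [Xx xB]]|nex].
  apply: (IH _ (col_mx x B)).
    suff : (\rank B < \rank (col_mx x B))%N by lia.
    rewrite -addsmxE.
    have := mxrank_leqif_sup (addsmxSr x B); rewrite addsmx_sub submx_refl andbT.
    by move=> [le]; rewrite (negbTE xB) => /negbT; move: le; lia.
  move=> i; rewrite -(splitK i); case: (split i) => j /=.
    by rewrite rowKu row_id // ; have -> : j = 0 by apply: ord1.
  by rewrite rowKd.
exists <<B>>%MS => x; rewrite genmxE; split=> [Xx|/submxP[c ->]]; last exact: Xsum.
by case: (boolP (x <= B)%MS) => // xB; case: nex; exists x.
Qed.

End LinearSets.

(** * Transitive algebras of matrices *)

Section Burnside.
Variable F : closedFieldType.

Lemma ex_singular_shift r (A : 'M[F]_r) : (0 < r)%N ->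
  exists a : F, (\rank (A - a%:M)%R < r)%N.
Proof.
move=> r0; have : size (char_poly A) != 1%N by rewrite size_char_poly; lia.
move=> /closed_rootP[a]; rewrite -eigenvalue_root_char => ev; exists a.
rewrite ltn_neqAle rank_leq_row andbT; apply: contraTneq ev => full.
by rewrite /eigenvalue /eigenspace -mxrank_eq0 mxrank_ker full subnn.
Qed.

(* Burnside's theorem, in the form that also applies to ideals *)
Lemma burnside r (B : 'M[F]_r -> Prop) :
  (0 < r)%N ->
  (forall a x y, B x -> B y -> B (a *: x + y)) ->
  (forall x y, B x -> B y -> B (x *m y)) ->
  (forall v y : 'rV[F]_r, v != 0 -> exists2 b, B b & v *m b = y) ->
  forall M, B M.
Proof.
move=> r0 Blin Bmul Btr.
pose e0 : 'rV[F]_r := delta_mx 0 (Ordinal r0).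
have e0n : e0 != 0.
  by apply/eqP => /rowP/(_ (Ordinal r0)); rewrite !mxE !eqxx; apply/eqP/oner_neq0.
have B0 : B 0.
  have [b Bb _] := Btr _ 0 e0n.
  have := Blin (-1) b b Bb Bb; by rewrite scaleN1r addNr.
have Bscale a x : B x -> B (a *: x) by move=> Bx; rewrite -[_ *: _]addr0; apply: Blin.
have Bsum (I : finType) (f : I -> 'M[F]_r) : (forall i, B (f i)) -> B (\sum_i f i).
  move=> Bf; elim/big_ind: _ => // x y Bx By; rewrite -[x]scale1r; exact: Blin.
(* As long as the rank of [b] exceeds one, some [b *m c *m b - a *: b] is nonzero of smaller
   rank. *)
have [b [Bb bn rb]] : exists b, [/\ B b, b != 0 & (\rank b <= 1)%N].
  have [b0 Bb0 vb0] := Btr _ e0 e0n.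
  have b0n : b0 != 0 by apply: contra_neq e0n => b00; rewrite -vb0 b00 mulmx0.
  have [l] := ubnP (\rank b0); elim: l b0 Bb0 b0n {vb0} => // l IH b Bb bn rbl.
  case: (leqP (\rank b) 1) => [|rb]; first by exists b.
  have [k [C [R [kE bE Cfull Rfree]]]] : exists k (C : 'M[F]_(r, k)) (R : 'M[F]_(k, r)),
      [/\ k = \rank b, b = C *m R, row_full C & row_free R].
    by exists _, (col_base b), (row_base b); rewrite mulmx_base col_base_full row_base_free.
  have [L LC] : exists L, L *m C = 1%:M by exists (pinvmx C); rewrite mulVpmx.
  have k0 : (0 < k)%N by lia.
  have k1 : (1 < k)%N by lia.
  set i1 := Ordinal k0; set i2 := Ordinal k1.
  have Rin (c : 'rV_k) : c *m R = 0 -> c = 0.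
    by move=> c0; apply: (row_free_inj Rfree); rewrite c0 mul0mx.
  have x1n : row i1 L *m b != 0.
    apply/eqP; rewrite bE mulmxA -row_mul LC => /Rin /rowP/(_ i1).
    by rewrite !mxE eqxx; apply/eqP/oner_neq0.
  (* Then [b *m c *m b] sends [row i1 L] to row [i2] of [R], while [b] sends it to row [i1]: no
     combination that involves the first can vanish. *)
  have [c Bc xc] := Btr _ (row i2 L) x1n.
  (* An eigenvalue [a] of the middle factor makes the rank drop. *)
  have [a ra] := ex_singular_shift (R *m c *m C) k0.
  pose b' := b *m c *m b - a *: b.
  have b'E : b' = C *m (R *m c *m C - a%:M) *m R.
    by rewrite /b' bE mulmxBr mulmxBl mul_mx_scalar -scalemxAl !mulmxA.
  apply: (IH b').
  - by rewrite /b' addrC -scaleNr; apply: Blin => //; do 2!apply: (Bmul _ _) => //.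
  - apply/eqP => b'0; have : row i1 L *m b' = 0 by rewrite b'0 mulmx0.
    rewrite /b' mulmxBr !mulmxA xc -scalemxAr bE !mulmxA -!(row_mul _ L C) LC.
    rewrite scalemxAl -mulmxBl => /Rin /rowP/(_ i2).
    by rewrite !mxE !eqxx /= mulr0 subr0; apply/eqP/oner_neq0.
  - rewrite b'E; apply: leq_ltn_trans (mxrankM_maxl _ _) _.
    apply: leq_ltn_trans (mxrankM_maxr _ _) _; apply: leq_trans ra _.
    by rewrite kE -ltnS.
have rb1 : \rank b = 1%N by move: bn rb; rewrite -mxrank_eq0; lia.
have [p [q bE]] : exists (p : 'cV[F]_r) (q : 'rV[F]_r), b = p *m q.
  by move: (mulmx_base b); move: (col_base b) (row_base b); rewrite rb1 => p q <-; exists p, q.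
have qn : q != 0 by apply: contra_neq bn => q0; rewrite bE q0 mulmx0.
have pn : p != 0 by apply: contra_neq bn => p0; rewrite bE p0 mul0mx.
(* [U] is the transposed orbit of the column [p]. It is everything, because by transitivity a
   nonzero row that annihilates the orbit would force [p = 0]. *)
have [U UP] := @linear_set_submx _ r (fun x => exists2 a, B a & (a *m p)^T = x)
  ltac:(exists 0; rewrite ?mul0mx ?trmx0 //)
  ltac:(move=> a _ _ [x Bx <-] [y By <-]; exists (a *: x + y); [exact: Blin|];
        rewrite mulmxDl -scalemxAl linearD linearZ; done).
have Ufull : row_full U.
  have : kermx U^T == 0.
    apply/rowV0P => x /sub_kermxP xU; apply: contra_neq_eq pn => xn.
    apply/matrixP => i j; rewrite (ord1 j) mxE.
    have [a Ba xa] := Btr x (delta_mx 0 i) xn.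
    have /submxP[c cE] : ((a *m p)^T <= U)%MS by apply/UP; exists a.
    have : x *m (a *m p) = 0 by rewrite -[a *m p]trmxK cE trmx_mul mulmxA xU mul0mx.
    by rewrite mulmxA xa -rowE => /rowP/(_ 0); rewrite !mxE.
  by rewrite -mxrank_eq0 mxrank_ker mxrank_tr subn_eq0 /row_full eqn_leq rank_leq_col.
move=> M; rewrite (matrix_sum_delta M); apply: (Bsum _ _) => i; apply: Bsum => j.
apply: Bscale.
have [a Ba ai] : exists2 a, B a & (a *m p)^T = delta_mx 0 i.
  by apply/UP; apply: submx_full.
have [a' Ba' aj] := Btr q (delta_mx 0 j) qn.
have -> : delta_mx i j = a *m b *m a'.
  rewrite bE !mulmxA -(mulmxA _ q) aj -[a *m p]trmxK ai trmx_delta.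
  by rewrite mul_delta_mx.
by do 2!apply: (Bmul _ _) => //.
Qed.

End Burnside.

(** * Block triangular nilpotent matrices *)

Section NilpotentPairs.
Variable F : fieldType.

Lemma mxpow_lblock m n (a : 'M[F]_m) (b : 'M[F]_n) c e : exists c',
  mxpow (block_mx a 0 c b) e = block_mx (mxpow a e) 0 c' (mxpow b e).
Proof.
elim: e => [|e [c' IH]]; first by exists 0; rewrite /= -scalar_mx_block.
exists (c *m mxpow a e + b *m c').
by rewrite !mxpowS IH mulmx_block !mul0mx !mulmx0 !addr0 add0r.
Qed.

Lemma nilp_lblock m n (a : 'M[F]_m) (b : 'M[F]_n) c :
  nilp (block_mx a 0 c b) <-> nilp a /\ nilp b.
Proof.
split=> [[e]|[[e ae] [f bf]]].
  have [c' ->] := mxpow_lblock a b c e; rewrite -(@block_mx0 _ m n m n).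
  by move=> /eq_block_mx[ae _ _ be]; split; exists e.
(* Past both exponents only the lower left block is left, and such a matrix squares to zero. *)
exists (maxn e f + maxn e f)%N; rewrite mxpowD.
have [c' ->] := mxpow_lblock a b c (maxn e f).
rewrite (mxpow_eq0W (leq_maxl e f) ae) (mxpow_eq0W (leq_maxr e f) bf).
by rewrite mulmx_block !mul0mx !mulmx0 !addr0 block_mx0.
Qed.

Lemma nilp_conj m n (P : 'M[F]_(m, n)) (P' : 'M[F]_(n, m)) A :
  P *m P' = 1%:M -> P' *m P = 1%:M -> nilp (P *m A *m P') <-> nilp A.
Proof.
move=> PP P'P; have Pf : row_free P by apply/row_freeP; exists P'.
have PF : row_full P by apply/row_fullP; exists P'.
have H : P *m A = (P *m A *m P') *m P by rewrite -mulmxA P'P mulmx1.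
by split; [apply: nilp_row_full PF H|apply: nilp_row_free Pf H].
Qed.

(** A kernel vector of [n], up to a scalar, becomes the first vector of the new basis. *)
Lemma nilp_row0 s (n : 'M[F]_(1 + s)) : nilp n ->
  exists P c b, P \in unitmx /\ P *m n *m invmx P = block_mx 0 0 c b.
Proof.
move=> [e ne].
have [v vn v0] : exists2 v : 'rV[F]_(1 + s), v *m n = 0 & v != 0.
  have [v vker v0] : exists2 v : 'rV[F]_(1 + s), (v <= kermx n)%MS & v != 0.
    apply/rowV0Pn; apply/negP; rewrite kermx_eq0 => nf.
    have : \rank (mxpow n e) = (1 + s)%N.
      elim: e {ne} => [|e IH]; first by rewrite mxrank1.
      by rewrite mxpowSr mxrankMfree.
    by rewrite ne mxrank0.
  by exists v => //; apply/sub_kermxP.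
have rv : \rank v = 1%N by rewrite rank_rV v0.
set P := row_ebase v; have Pu : P \in unitmx by apply: row_ebase_unit.
have : (pid_mx 1 : 'M[F]_(1, 1 + s)) *m P *m n = 0.
  have := mulmx_ebase v; rewrite rv -/P => vE.
  have -> : (pid_mx 1 : 'M[F]_(1, 1 + s)) *m P = invmx (col_ebase v) *m v.
    by rewrite -[X in _ = _ *m X]vE !mulmxA mulVmx ?col_ebase_unit // mul1mx.
  by rewrite -mulmxA vn mulmx0.
move=> /(congr1 (fun M => M *m invmx P)); rewrite mul0mx -!mulmxA (mulmxA P).
set M := P *m n *m invmx P => M0.
exists P, (dlsubmx M), (drsubmx M); split=> //.
rewrite -/M -[M in LHS]submxK.
have uM : usubmx M = 0.
  by rewrite -M0 pid_mx_row -{2}(vsubmxK M) mul_row_col mul1mx mul0mx addr0.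
by rewrite /ulsubmx /ursubmx uM !linear0.
Qed.

(** After conjugating [n], both matrices are strictly triangular for one common flag, built one
    kernel vector at a time. *)
Lemma nilp_pair s (n n' : 'M[F]_s) : nilp n -> nilp n' ->
  exists U U', U *m U' = 1%:M /\
    forall a b, nilp (a *: (U *m n *m U') + b *: n').
Proof.
elim: s n n' => [|s IH] n n' nn nn'.
  exists 1%:M, 1%:M; split=> [|a b]; first exact: mulmx1.
  by exists 0%N; apply/matrixP; case.
have [P [c [b [Pu PE]]]] := nilp_row0 (n := n) nn.
have [P' [c' [b' [P'u P'E]]]] := nilp_row0 (n := n') nn'.
have [_ nb] : nilp (0 : 'M[F]_1) /\ nilp b.
  by apply/(nilp_lblock _ _ c); rewrite -PE; apply/nilp_conj => //; rewrite ?mulmxV ?mulVmx.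
have [_ nb'] : nilp (0 : 'M[F]_1) /\ nilp b'.
  by apply/(nilp_lblock _ _ c'); rewrite -P'E; apply/nilp_conj => //; rewrite ?mulmxV ?mulVmx.
have [U0 [U1 [U01 U0nil]]] := IH b b' nb nb'.
pose D : 'M[F]_(1 + s) := block_mx 1%:M 0 0 U0.
pose D' : 'M[F]_(1 + s) := block_mx 1%:M 0 0 U1.
have DD' : D *m D' = 1%:M.
  rewrite /D /D' mulmx_block !mul0mx !mulmx0 !addr0 add0r mul1mx U01.
  by rewrite -scalar_mx_block.
exists (invmx P' *m D *m P), (invmx P *m D' *m P'); split.
  by rewrite !mulmxA mulmxK // -(mulmxA _ D) DD' mulmx1 mulVmx.
move=> x y; apply/(@nilp_conj _ _ P' (invmx P')); rewrite ?mulmxV ?mulVmx //.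
rewrite mulmxDr mulmxDl -!scalemxAr -!scalemxAl P'E.
have -> : P' *m (invmx P' *m D *m P *m n *m (invmx P *m D' *m P')) *m invmx P'
    = D *m block_mx 0 0 c b *m D'.
  by rewrite -PE !mulmxA mulmxV // mul1mx mulmxK.
rewrite /D /D' !mulmx_block !mul0mx !mulmx0 !addr0 !add0r !mul0mx.
rewrite !scale_block_mx add_block_mx !scaler0 !addr0; apply/nilp_lblock; split=> //.
by exists 1%N; rewrite mxpow1.
Qed.

End NilpotentPairs.

(* No axioms are imposed on the operations of [T]: all identities are tested in
   representations. *)
Section AlgebraRep.
Variables (F : closedFieldType) (T : Type).
Variables (tadd tmul : T -> T -> T) (tscale : F -> T -> T) (tone : T).

Definition is_rep n (rho : T -> 'M[F]_n) : Prop :=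
  [/\ forall x y, rho (tadd x y) = rho x + rho y,
      forall x y, rho (tmul x y) = rho x *m rho y,
      forall a x, rho (tscale a x) = a *: rho x
    & rho tone = 1%:M].

Definition tpow x e := iter e (tmul x) tone.

Lemma rep_tpow n (rho : T -> 'M[F]_n) x e : is_rep rho -> rho (tpow x e) = mxpow (rho x) e.
Proof.
move=> [_ rM _ r1]; elim: e => [|e IH] //=.
by rewrite rM IH.
Qed.

(** By Cayley-Hamilton the inverse is a polynomial in [rho u], hence again a value of [rho]. *)
Lemma rep_inv n (rho : T -> 'M[F]_n) u : is_rep rho -> rho u \in unitmx ->
  exists v, rho v = invmx (rho u).
Proof.
move=> [rD rM rZ r1] uu; case: n rho rD rM rZ r1 uu => [|n] rho rD rM rZ r1 uu.
  by exists u; apply/matrixP; case.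
have hornerT p : exists w, rho w = horner_mx (rho u) p.
  elim/poly_ind: p => [|p c [w wE]].
    by exists (tscale 0 tone); rewrite rZ scale0r rmorph0.
  exists (tadd (tmul w u) (tscale c tone)); rewrite rD rM rZ r1 wE.
  by rewrite rmorphD rmorphM /= horner_mx_X horner_mx_C scalemx1.
set p := char_poly (rho u).
have p0 : p`_0 != 0.
  rewrite /p char_poly_det mulf_neq0 ?signr_eq0 // -unitfE -unitmxE.
  exact: uu.
have [w wE] := hornerT (drop_poly 1 p).
exists (tscale (- (p`_0)^-1) w); rewrite rZ wE.
have := Cayley_Hamilton (rho u); rewrite -/p -{1}(poly_take_drop 1 p).
have -> : take_poly 1 p = (p`_0)%:P by apply/polyP => -[|i]; rewrite !coefE.
rewrite expr1 rmorphD rmorphM /= horner_mx_X horner_mx_C => /eqP.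
rewrite addrC addr_eq0 => /eqP qE.
rewrite -[RHS]mul1mx; apply: (canRL (mulmxK uu)); rewrite -scalemxAl.

move: qE; rewrite [_ * _](erefl : _ = _ *m _) => ->.
by rewrite scaleNr scalerN opprK scale_scalar_mx mulVf.
Qed.

End AlgebraRep.

(** * Simple submodules and conjugacy by units of the algebra *)

Section NilConjugacy.
Variables (F : closedFieldType) (T : Type).
Variables (tadd tmul : T -> T -> T) (tscale : F -> T -> T) (tone : T).
Local Notation is_rep := (is_rep tadd tmul tscale tone).

Lemma rep_conj m n (rho : T -> 'M[F]_n) (P : 'M[F]_(m, n)) (P' : 'M[F]_(n, m)) :
  P *m P' = 1%:M -> P' *m P = 1%:M -> is_rep rho -> is_rep (fun x => P *m rho x *m P').
Proof.
move=> PP P'P [rD rM rZ r1]; split.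
- by move=> x y; rewrite rD mulmxDr mulmxDl.
- by move=> x y; rewrite rM !mulmxA -[_ *m P' *m P]mulmxA P'P mulmx1.
- by move=> a x; rewrite rZ -scalemxAr -scalemxAl.
- by rewrite r1 mulmx1.
Qed.

Lemma rep_blocks m n (rho : T -> 'M[F]_(m + n)) : is_rep rho ->
  (forall x, ursubmx (rho x) = 0) ->
  is_rep (fun x => ulsubmx (rho x)) /\ is_rep (fun x => drsubmx (rho x)).
Proof.
move=> [rD rM rZ r1] ur0.
have bE x : rho x = block_mx (ulsubmx (rho x)) 0 (dlsubmx (rho x)) (drsubmx (rho x)).
  by rewrite -(ur0 x) submxK.
split; split=> [x y|x y|a x|].
- by rewrite rD /ulsubmx !linearD.
- rewrite rM {1}(bE x) {1}(bE y) mulmx_block block_mxKul.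
  by rewrite !mul0mx addr0.
- by rewrite rZ /ulsubmx !linearZ.
- by rewrite r1 scalar_mx_block block_mxKul.
- by rewrite rD /drsubmx !linearD.
- rewrite rM {1}(bE x) {1}(bE y) mulmx_block block_mxKdr.
  by rewrite !mulmx0 add0r.
- by rewrite rZ /drsubmx !linearZ.
- by rewrite r1 scalar_mx_block block_mxKdr.
Qed.

Lemma ex_simple_submx n (rho : T -> 'M[F]_n) : (0 < n)%N ->
  exists U : 'M[F]_n, [/\ U != 0, forall x, (U *m rho x <= U)%MS &
    forall U' : 'M[F]_n, U' != 0 -> (U' <= U)%MS ->
      (forall x, (U' *m rho x <= U')%MS) -> (U <= U')%MS].
Proof.
move=> n0; suff key l (U : 'M[F]_n) : (\rank U <= l)%N -> U != 0 ->
    (forall x, (U *m rho x <= U)%MS) ->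
    exists U : 'M[F]_n, [/\ U != 0, forall x, (U *m rho x <= U)%MS &
    forall U' : 'M[F]_n, U' != 0 -> (U' <= U)%MS ->
      (forall x, (U' *m rho x <= U')%MS) -> (U <= U')%MS].
  apply: (key n 1%:M); rewrite ?mxrank1 -?mxrank_eq0 ?mxrank1 -?lt0n //.
  by move=> x; rewrite submx1.
elim: l U => [|l IH] U rU Un stU.
  by move: rU Un; rewrite leqn0 mxrank_eq0 => ->.
case: (classic (exists U' : 'M[F]_n, [/\ U' != 0, (U' <= U)%MS,
    forall x, (U' *m rho x <= U')%MS & ~~ (U <= U')%MS])) => [|nex].
  move=> [U' [U'n U'U stU' UU']]; apply: (IH U') => //.
  rewrite -ltnS; apply: leq_trans rU;
  by rewrite (ltn_leqif (mxrank_leqif_sup U'U)).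
exists U; split=> // U' U'n U'U stU'.
by case: (boolP (U <= U')%MS) => // UU'; case: nex; exists U'.
Qed.

(** The basis is adapted to a minimal nonzero invariant subspace: [rho1] is the simple action on it
    and [rho2] the action on the quotient. *)
Lemma rep_split n (rho : T -> 'M[F]_n) : (0 < n)%N -> is_rep rho ->
  exists r q (P : 'M[F]_(r + q, n)) (P' : 'M[F]_(n, r + q))
         (rho1 : T -> 'M[F]_r) (rho2 : T -> 'M[F]_q) c,
  [/\ (0 < r)%N /\ (q < n)%N, P *m P' = 1%:M /\ P' *m P = 1%:M,
      is_rep rho1 /\ is_rep rho2,
      forall x, P *m rho x *m P' = block_mx (rho1 x) 0 (c x) (rho2 x) &
      forall U : 'M[F]_r, U != 0 -> (forall x, (U *m rho1 x <= U)%MS) -> row_full U].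
Proof.
move=> n0 rrep; have [U [Un stU minU]] := ex_simple_submx rho n0.
set R := row_base U; set C := row_base U^C%MS.
have r0 : (0 < \rank U)%N by rewrite lt0n mxrank_eq0.
have rE := mxrank_compl U.
have Ule := rank_leq_col U.
set P := col_mx R C.
have Pfull : row_full P.
  have := addsmx_compl_full U; rewrite -!sub1mx => /submx_trans; apply.
  by rewrite -addsmxE addsmxS // eq_row_base.
have Pfree : row_free P by rewrite /row_free (eqP Pfull) rE; apply/eqP; lia.
set P' := pinvmx P.
have PP' : P *m P' = 1%:M by apply: mulmxVp.
have P'P : P' *m P = 1%:M by apply: mulVpmx.
have RP' : R *m P' = row_mx 1%:M 0.
  have := PP'; rewrite /P mul_col_mx scalar_mx_block /block_mx.
  by move=> /eq_col_mx[].
pose M x := P *m rho x *m P'.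
have stR x : exists Y, R *m rho x = Y *m R.
  by apply/submxP; rewrite (eqmxMr _ (eq_row_base U)) eq_row_base.
have uM x Y : R *m rho x = Y *m R -> usubmx (M x) = row_mx Y 0.
  move=> RY; rewrite /M /P !mul_col_mx col_mxKu RY -mulmxA RP' mul_mx_row.
  by rewrite mulmx1 mulmx0.
have ur0 x : ursubmx (M x) = 0.
  by have [Y /uM MY] := stR x; rewrite /ursubmx MY row_mxKr.
have Mrep := rep_conj PP' P'P rrep; have [rep1 rep2] := rep_blocks Mrep ur0.
exists _, _, P, P', (fun x => ulsubmx (M x)), (fun x => drsubmx (M x)),
  (fun x => dlsubmx (M x)); split.
- by split=> //; lia.
- by [].
- by [].
- by move=> x; rewrite -(ur0 x) submxK.
move=> U1 U1n st1.
have RM x : R *m rho x = ulsubmx (M x) *m R.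
  by have [Y RY] := stR x; rewrite /ulsubmx (uM _ _ RY) row_mxKl.
have : (U <= <<U1 *m R>>)%MS.
  apply: minU.
  - rewrite -mxrank_eq0 genmxE mxrankMfree ?row_base_free // mxrank_eq0 //.
  - by rewrite genmxE (submx_trans (submxMl _ _)) // eq_row_base.
  - move=> x; rewrite genmxE (eqmxMr _ (genmxE _)) -mulmxA RM mulmxA submxMr //.
rewrite genmxE -(eq_row_base U) -/R => /submxP[Y RE].
apply/row_fullP; exists Y; apply: (row_free_inj (row_base_free U)).
by rewrite -mulmxA -RE mul1mx.
Qed.

(* If [ker rho2] is not killed by the simple representation [rho1], its image
   is an ideal of a transitive algebra, hence everything. *)
Lemma ideal_surj r q (rho1 : T -> 'M[F]_r) (rho2 : T -> 'M[F]_q) :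
  (0 < r)%N -> is_rep rho1 -> is_rep rho2 ->
  (forall U : 'M[F]_r, U != 0 -> (forall x, (U *m rho1 x <= U)%MS) -> row_full U) ->
  ~ (forall z, rho2 z = 0 -> rho1 z = 0) ->
  forall M, exists2 z, rho2 z = 0 & rho1 z = M.
Proof.
move=> r0 [D1 M1 Z1 o1] [D2 M2 Z2 o2] irr nker.
apply: (burnside (B := fun M => exists2 z, rho2 z = 0 & rho1 z = M)) => //.
- move=> a _ _ [x x0 <-] [y y0 <-]; exists (tadd (tscale a x) y).
    by rewrite D2 Z2 x0 y0 scaler0 addr0.
  by rewrite D1 Z1.
- move=> _ _ [x x0 <-] [y y0 <-]; exists (tmul x y); last by rewrite M1.
  by rewrite M2 x0 mul0mx.
move=> v y vn.
have [U UP] := @linear_set_submx _ r (fun w => exists2 z, rho2 z = 0 & v *m rho1 z = w)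
  ltac:(exists (tscale 0 tone); rewrite ?Z1 ?Z2 !scale0r ?mulmx0 //)
  ltac:(move=> a _ _ [x x0 <-] [z z0 <-]; exists (tadd (tscale a x) z);
        [rewrite D2 Z2 x0 z0 scaler0 addr0; done|
         rewrite D1 Z1 mulmxDr -scalemxAr; done]).
have stU x : (U *m rho1 x <= U)%MS.
  apply/row_subP => i; rewrite row_mul.
  have [z z0 <-] : exists2 z, rho2 z = 0 & v *m rho1 z = row i U by apply/UP/row_sub.
  by apply/UP; exists (tmul z x); rewrite ?M1 ?M2 ?z0 ?mul0mx ?mulmxA.
case: (eqVneq U 0) => [U0|Un]; last first.
  have [z z0 zy] : exists2 z, rho2 z = 0 & v *m rho1 z = y.
    by apply/UP; apply: submx_full; apply: irr.
  by exists (rho1 z) => //; exists z.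
(* Here the ideal kills [v]. The vectors killed by the ideal form an invariant subspace [K], nonzero
   and hence everything, so the ideal acts by zero. *)
case: nker => z z0.
have [K KP] := @linear_set_submx _ r (fun w => forall z, rho2 z = 0 -> w *m rho1 z = 0)
  ltac:(move=> ? _; rewrite mul0mx; done)
  ltac:(move=> a x y' Hx Hy ? Hz; rewrite mulmxDl -scalemxAl Hx // Hy // scaler0 addr0; done).
have vK : (v <= K)%MS.
  apply/KP => x x0; apply/eqP; rewrite -submx0 -U0; apply/UP; by exists x.
have Kn : K != 0 by apply: contra_neq vn => K0; apply/eqP; rewrite -submx0 -K0.
have stK x : (K *m rho1 x <= K)%MS.
  apply/row_subP => i; rewrite row_mul; apply/KP => z' z'0.
  have /KP H := row_sub i K.
  by rewrite -mulmxA -M1 H // M2 z'0 mulmx0.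
apply/row_matrixP => i; rewrite rowE row0.
by have /KP -> : ((delta_mx 0 i : 'rV[F]_r) <= K)%MS by apply: submx_full; apply: irr.
Qed.

(** Induction on [n]: the quotient by a simple submodule provides [u0], which is then corrected on
    the submodule. *)
Theorem rep_nil_conj n (rho : T -> 'M[F]_n) x y : is_rep rho ->
  nilp (rho x) -> nilp (rho y) ->
  exists u v, rho u *m rho v = 1%:M /\
    forall a b, nilp (a *: (rho u *m rho x *m rho v) + b *: rho y).
Proof.
elim/ltn_ind: n rho => n IH rho rrep nx ny.
case: (posnP n) => [n0|n0].
  move: rho rrep nx ny; rewrite n0 => rho _ _ _.
  by exists tone, tone; split=> [|a b]; [|exists 0%N]; apply/matrixP; case.
have [r [q [P [P' [rho1 [rho2 [c [[r0 qn] [PP' P'P] [rep1 rep2] bE irr]]]]]]]] :=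
  rep_split n0 rrep.
have nilE z : nilp (rho z) <-> nilp (rho1 z) /\ nilp (rho2 z).
  by rewrite -(nilp_conj (rho z) PP' P'P) bE nilp_lblock.
have [nx1 nx2] := (nilE x).1 nx; have [ny1 ny2] := (nilE y).1 ny.
have [u0 [v0 [uv0 nil0]]] := IH q qn rho2 rep2 nx2 ny2.
have [D1 M1 Z1 o1] := rep1; have [D2 M2 Z2 o2] := rep2.
(* The inverse may be sought in each diagonal block separately: [rho u] is invertible when both
   blocks are, and inverses are unique. *)
suff [u [v1 [v2 [uv1 uv2 nil1 nil2]]]] : exists u v1 v2,
    [/\ rho1 u *m v1 = 1%:M, rho2 u *m v2 = 1%:M,
        forall a b, nilp (a *: (rho1 u *m rho1 x *m v1) + b *: rho1 y) &
        forall a b, nilp (a *: (rho2 u *m rho2 x *m v2) + b *: rho2 y)].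
  have [u1 _] := mulmx1_unit uv1; have [u2 _] := mulmx1_unit uv2.
  have uu : rho u \in unitmx.
    have bu : P *m rho u *m P' \in unitmx.
      by rewrite bE unitmxE det_lblock unitrM -!unitmxE u1 u2.
    have ruE : rho u = P' *m (P *m rho u *m P') *m P.
      by rewrite !mulmxA P'P mul1mx -mulmxA P'P mulmx1.
    move: bu ruE; move: (P *m rho u *m P') => B Bu ruE.
    have [] // := @mulmx1_unit _ _ (rho u) (P' *m invmx B *m P).
    by rewrite ruE !mulmxA -(mulmxA _ P P') PP' mulmx1 -(mulmxA P') mulmxV // mulmx1.
  have [v vE] := rep_inv rrep uu.
  have uv : rho u *m rho v = 1%:M by rewrite vE mulmxV.
  exists u, v; split=> // a b.
  have [D M Z o] := rrep.
  have := bE (tmul u v); rewrite M uv mulmx1 PP' scalar_mx_block M1 M2.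
  move=> /eq_block_mx[uv1' _ _ uv2'].
  have inj m (A B C : 'M[F]_m) : 1%:M = A *m B -> A *m C = 1%:M -> B = C.
    by move=> /esym/mulmx1C BA eAC; rewrite -[B]mulmx1 -eAC mulmxA BA mul1mx.
  suff : nilp (rho (tadd (tscale a (tmul (tmul u x) v)) (tscale b y))).
    by rewrite D !Z !M.
  apply/nilE; rewrite D1 D2 !Z1 !Z2 !M1 !M2.
  by rewrite (inj _ _ _ _ uv1' uv1) (inj _ _ _ _ uv2' uv2).
(* If [rho2] determines [rho1], then [u0] works on the submodule too: invertibility and nilpotency
   are vanishing conditions, inherited from [rho2]. *)
case: (classic (forall z, rho2 z = 0 -> rho1 z = 0)) => [ker|nker].
  exists u0, (rho1 v0), (rho2 v0); split=> // [|a b].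
    have : rho1 (tadd (tmul u0 v0) (tscale (-1) tone)) = 0.
      by apply: ker; rewrite D2 Z2 M2 uv0 o2 scaleN1r subrr.
    by rewrite D1 Z1 M1 o1 scaleN1r => /eqP; rewrite subr_eq0 => /eqP.
  have [e ne] := nil0 a b; exists e.
  pose z := tadd (tscale a (tmul (tmul u0 x) v0)) (tscale b y).
  have := ker (tpow tmul tone z e).
  rewrite (rep_tpow z e rep1) (rep_tpow z e rep2) /z D1 D2 !Z1 !Z2 !M1 !M2.
  exact.
(* Otherwise an element killed by [rho2] turns [rho1 u0] into any prescribed matrix, here the [U] of
   [nilp_pair]. *)
have surj := ideal_surj r0 rep1 rep2 irr nker.
have [U [U' [UU' nilU]]] := nilp_pair nx1 ny1.
have [z z0 zE] := surj (U - rho1 u0).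
exists (tadd u0 z), U', (rho2 v0).
by rewrite D1 D2 z0 zE addr0 addrC subrK; split.
Qed.

End NilConjugacy.
(** * Cokernels *)

Section Biproduct.
Variable F : fieldType.

(** [R i] is the inclusion and [S i] the projection of a summand. Coordinates are enumerated from
    pairs of an index in [P] and a position, which avoids casts between dimensions. *)
Lemma biproduct (I : finType) (P : pred I) (d : I -> nat) :
  exists D (R : forall i, 'M[F]_(d i, D)) (S : forall i, 'M[F]_(D, d i)),
  [/\ forall i, P i -> R i *m S i = 1%:M, forall i j, i != j -> R i *m S j = 0,
      \sum_(i | P i) S i *m R i = 1%:M & (D = \sum_(i | P i) d i)%N].
Proof.
pose X := [set u : {i : I & 'I_(d i)} | P (tag u)].
pose ev (y : 'I_#|X|) := enum_val y.
pose R i : 'M[F]_(d i, #|X|) :=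
  \matrix_(x, y) (ev y == Tagged (fun i => 'I_(d i)) x)%:R.
exists #|X|, R, (fun i => (R i)^T); split.
- move=> i Pi; apply/matrixP => x x'; rewrite !mxE.
  transitivity (\sum_(u in X) ((u == Tagged (fun i => 'I_(d i)) x)%:R
      * (u == Tagged (fun i => 'I_(d i)) x')%:R : F)).
    by rewrite [RHS]big_enum_val; apply: eq_bigr => y _; rewrite !mxE.
  rewrite (bigD1 (Tagged (fun i => 'I_(d i)) x)) ?inE //= eqxx mul1r big1 ?addr0.
    by rewrite -tag_eqE /tag_eq eqxx /= tagged_asE.
  by move=> u /andP[_ /negbTE ->]; rewrite mul0r.
- move=> i j ij; apply/matrixP => x x'; rewrite !mxE big1 // => y _; rewrite !mxE.
  case: eqP => [->|]; last by rewrite mul0r.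
  by rewrite -tag_eqE /tag_eq /= (negbTE ij) mulr0.
- apply/matrixP => y y'; rewrite summxE !mxE.
  transitivity (\sum_(u : {i : I & 'I_(d i)} | P (tag u) && true)
     (ev y == u)%:R * (ev y' == u)%:R : F).
    rewrite -(sig_big_dep P (fun _ => xpredT)
      (fun i x => (ev y == Tagged (fun i => 'I_(d i)) x)%:R
        * (ev y' == Tagged (fun i => 'I_(d i)) x)%:R)) /=.
    by apply: eq_bigr => i _; rewrite mxE; apply: eq_bigr => x _; rewrite !mxE.
  rewrite (bigD1 (ev y)) /=; last by have := enum_valP y; rewrite inE => ->.
  rewrite eqxx mul1r big1 ?addr0; first by rewrite (inj_eq enum_val_inj) eq_sym.
  by move=> u /andP[_]; rewrite eq_sym => /negbTE ->; rewrite mul0r.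
- rewrite -sum1_card (eq_bigl (fun u => P (tag u) && true)); last first.
    by move=> u; rewrite inE andbT.
  rewrite -(sig_big_dep P (fun _ => xpredT) (fun i x => 1%N)) /=.
  by apply: eq_bigr => i _; rewrite sum1_card card_ord.
Qed.

End Biproduct.

Section MatrixCokernel.
Variables (F : fieldType) (m D c : nat) (H : 'M[F]_(m, D)) (G : 'M[F]_(D, c)).
Hypotheses (HG : H *m G = 0) (Gfull : row_full G) (kerG : (kermx G <= H)%MS).

Lemma cokernel_kermx : (kermx G :=: H)%MS.
Proof. by apply/eqmxP; rewrite kerG; apply/sub_kermxP. Qed.

(** Rank-nullity for [G] on the sum of the row spaces of [mxpow A J] and [H]; the kernel there is
    the row space of [H]. *)
Lemma cokernel_rank (A : 'M[F]_D) (B : 'M[F]_c) J : G *m B = A *m G ->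
  (\rank (mxpow B J) + \rank H = \rank (col_mx (mxpow A J) H))%N.
Proof.
move=> GB; rewrite -(mxrank_mul_ker (col_mx (mxpow A J) H) G); congr (_ + _)%N.
  rewrite mul_col_mx HG -(mxpow_intertwine J GB) -addsmxE addsmx0.
  by rewrite eqmxMfull.
have -> : \rank H = \rank (kermx G) by rewrite cokernel_kermx.
apply/eqP; rewrite eqn_leq; apply/andP; split; apply: mxrankS; last exact: capmxSr.
by rewrite sub_capmx submx_refl andbT cokernel_kermx -addsmxE addsmxSr.
Qed.

(** Rank-nullity for [G] on the row space of [mxpow A J]; the kernel there contains
    [mxpow L J *m H]. *)
Lemma cokernel_rank_add (A : 'M[F]_D) (B : 'M[F]_c) (L : 'M[F]_m) J :
  row_free H -> G *m B = A *m G -> H *m A = L *m H ->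
  (\rank (mxpow B J) + \rank (mxpow L J) <= \rank (mxpow A J))%N.
Proof.
move=> Hfree GB HA; rewrite -(mxrank_mul_ker (mxpow A J) G).
rewrite -(mxpow_intertwine J GB) eqmxMfull // leq_add2l.
rewrite -(mxrankMfree (mxpow L J) Hfree) -(mxpow_intertwine J HA).
apply: mxrankS; rewrite sub_capmx submxMl; apply/sub_kermxP.
by rewrite (mxpow_intertwine J HA) -mulmxA HG mulmx0.
Qed.

Lemma cokernel_induced (A : 'M[F]_D) (L : 'M[F]_m) : H *m A = L *m H ->
  exists B, G *m B = A *m G.
Proof.
move=> HA; exists (pinvmx G *m A *m G).
have /submx_trans : (G *m pinvmx G - 1%:M <= kermx G)%MS.
  by apply/sub_kermxP; rewrite mulmxBl mul1mx -mulmxA mulVpmx // mulmx1 subrr.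
move=> /(_ _ _ kerG)/submxP[Y YE].
have -> : G *m (pinvmx G *m A *m G) = (G *m pinvmx G) *m (A *m G).
  by rewrite -(mulmxA (pinvmx G)) (mulmxA G).
rewrite -(subrK 1%:M (G *m pinvmx G)) YE mulmxDl mul1mx -mulmxA (mulmxA H) HA.
by rewrite -mulmxA HG !mulmx0 add0r.
Qed.

Lemma cokernel_restrict (A : 'M[F]_D) (B : 'M[F]_c) : G *m B = A *m G ->
  exists L, H *m A = L *m H.
Proof.
move=> GB; apply/submxP; apply: submx_trans kerG; apply/sub_kermxP.
by rewrite -mulmxA -GB mulmxA HG mul0mx.
Qed.

End MatrixCokernel.

Section OutArrows.
Variables (F : fieldType) (n : nat) (Q : quiver n) (d : 'I_n -> nat) (k : 'I_n).
Implicit Types (X V : rep F Q d).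

(** Equality of vertices has unique proofs, so any [e] may replace the proof inside [outk] and then
    be destructed. *)
Lemma outk_cast V a (e : qsrc Q a = k) :
  outk V k a = castmx (congr1 d e, erefl) (V a).
Proof.
rewrite /outk; case: {-}_ / idP => [h|]; last by move=> /(_ (introT eqP e)).
by congr castmx; congr pair; apply: eq_irrelevance.
Qed.

Lemma outk_intertwine X V (B : forall i, 'M[F]_(d i)) a A : qsrc Q a == k ->
  X a *m A = B (qsrc Q a) *m V a <-> outk X k a *m A = B k *m outk V k a.
Proof.
move=> /eqP e; rewrite !(outk_cast _ e).
by case: _ / e; rewrite !castmx_id.
Qed.

Lemma outk_lin X V x y a :
  outk (fun b => x *: X b + y *: V b) k a = x *: outk X k a + y *: outk V k a.
Proof.
case: (eqVneq (qsrc Q a) k) => [e|ne].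
  by rewrite !(outk_cast _ e); case: _ / e; rewrite !castmx_id.
rewrite /outk; case: {-}_ / idP => [h|_]; first by rewrite h in ne.
by rewrite !scaler0 addr0.
Qed.

Lemma rep_of_outk (Y : forall a, 'M[F]_(d k, d (qtgt Q a))) :
  exists X : rep F Q d, (forall a, qsrc Q a == k -> outk X k a = Y a) /\
    (forall a, qsrc Q a != k -> X a = 0).
Proof.
exists (fun a => if @eqP _ (qsrc Q a) k is ReflectT e
  then castmx (congr1 d (esym e), erefl) (Y a) else 0); split=> a.
  move=> /eqP e; rewrite (outk_cast _ e); case: eqP => // e'.
  rewrite (eq_irrelevance e' e); move: (Y a); case: _ / e => y.
  by rewrite !castmx_id.
by case: eqP.
Qed.

End OutArrows.
(** * An explicit homomorphism with large cokernel *)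

Section ExplicitHom.
Variable F : fieldType.

Lemma jtype_generators m (A : 'M[F]_m) : nilp A ->
  exists v : nat -> 'rV[F]_m, (forall p, v p *m mxpow A (jtype A p) = 0) /\ generates A v.
Proof.
move=> nA; have [v [v0 vgen]] := jordan_generators nA; exists v; split=> // p.
case: (ltnP (jtype A p) m) => jm; last by rewrite nilp_mxpow_size // mulmx0.
by apply: v0; rewrite -jtype_le.
Qed.

Lemma mxrank_sums_le (I : Type) (r : seq I) (P : pred I) n (A : I -> 'M[F]_n) :
  (\rank (\sum_(i <- r | P i) A i)%MS <= \sum_(i <- r | P i) \rank (A i))%N.
Proof.
elim/big_ind2: _ => [|U a V b Ua Vb|//]; first by rewrite mxrank0.
apply: leq_trans (leq_add Ua Vb).
by rewrite mxrank_adds_leqif.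
Qed.

(* A homomorphism of [F[X]]-modules may be prescribed on Jordan generators: its
   graph is the submodule generated by the pairs [(u p, w p)]. *)
Lemma hom_of_generators m D (A : 'M[F]_m) (B : 'M[F]_D) la u (w : nat -> 'rV[F]_D) :
  partition_of la m -> generates A u ->
  (forall p, u p *m mxpow A (la p) = 0) -> (forall p, w p *m mxpow B (la p) = 0) ->
  exists H : 'M[F]_(m, D), H *m B = A *m H /\ forall p, u p *m H = w p.
Proof.
move=> [_ la0 lasum] ugen uA wB.
pose x p i := row_mx (u p *m mxpow A i) (w p *m mxpow B i).
pose G := (\sum_(p < m) \sum_(i < la p) <<x p i>>)%MS.
have xG p i : (x p i <= G)%MS.
  case: (ltnP i (la p)) => ip; last first.
    by rewrite /x -(subnKC ip) !mxpowD !mulmxA uA wB !mul0mx row_mx0 sub0mx.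
  have pm : (p < m)%N by rewrite ltnNge; apply/negP => /la0 p0; rewrite p0 in ip.
  apply: (sumsmx_sup (Ordinal pm)) => //; apply: (sumsmx_sup (Ordinal ip)) => //.
  by rewrite genmxE.
(* At most [m] vectors span [G], and its projection to the first factor is onto; hence [G] is the
   graph of a map. *)
have rkG : (\rank G <= m)%N.
  rewrite -[X in (_ <= X)%N]lasum; apply: leq_trans (mxrank_sums_le _ _ _) _.
  apply: leq_sum => p _; apply: leq_trans (mxrank_sums_le _ _ _) _.
  rewrite -[X in (_ <= X)%N]card_ord -sum1_card; apply: leq_sum => i _.
  by rewrite genmxE rank_leq_row.
have lfull : row_full (lsubmx G).
  suff : row_full <<lsubmx G>>%MS by rewrite -!sub1mx genmxE.
  apply: ugen => p i; rewrite genmxE.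
  have /submxP[c xE] := xG p i; apply/submxP; exists c.
  by rewrite -[LHS](row_mxKl _ (w p *m mxpow B i)) -/(x p i) xE -mulmx_lsub.
set Z := pinvmx (lsubmx G); pose H := Z *m rsubmx G.
have ZG : row_mx 1%:M H = Z *m G.
  by rewrite -[in RHS](hsubmxK G) mul_mx_row mulVpmx.
have GH : (G <= row_mx 1%:M H)%MS.
  have sub : (row_mx 1%:M H <= G)%MS by rewrite ZG submxMl.
  rewrite -(geq_leqif (mxrank_leqif_sup sub)); apply: leq_trans rkG _.
  suff /eqP -> : row_free (row_mx 1%:M H) by [].
  apply/row_freeP; exists (col_mx 1%:M 0).
  by rewrite mul_row_col mulmx1 mulmx0 addr0.
have key p i : u p *m mxpow A i *m H = w p *m mxpow B i.
  have /submxP[c] := submx_trans (xG p i) GH.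
  by rewrite mul_mx_row mulmx1 => /eq_row_mx[-> ->].
clearbody H; exists H; split; last by move=> p; have := key p 0%N; rewrite !mulmx1.
have /ugen : forall p i, (u p *m mxpow A i <= kermx (H *m B - A *m H))%MS.
  move=> p i; apply/sub_kermxP; rewrite mulmxBr !mulmxA key.
  by rewrite -(mulmxA (u p)) -mxpowSr key mxpowSr mulmxA subrr.
rewrite -sub1mx => /sub_kermxP; rewrite mul1mx => /eqP.
by rewrite subr_eq0 => /eqP.
Qed.

(* The generator of the block [la j] goes to a multiple of the generator of the
   block [mu (t + 2 j)] plus the generator of the block [mu (t + 2 j + 1)]; the
   latter thus becomes redundant in the cokernel. *)
Lemma interlaced_hom m D (A : 'M[F]_m) (B : 'M[F]_D) t mu la M u e :
  partition_of la m -> generates A u -> (forall p, u p *m mxpow A (la p) = 0) ->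
  generates B e -> (forall p, e p *m mxpow B (mu p) = 0) ->
  interlaced t mu la -> (forall p, M <= p -> diffp t mu la p = 0)%N ->
  exists H : 'M[F]_(m, D), H *m B = A *m H /\
    forall J, (D <= \rank (col_mx (mxpow B J) H)
                  + \sum_(p < M) minn J (diffp t mu la p))%N.
Proof.
move=> lam ugen uA egen eB inter ga0; set ga := diffp t mu la.
pose w j := e (t + 2 * j)%N *m mxpow B (mu (t + 2 * j) - la j)%N + e (t + 2 * j)%N.+1.
have e0 p i : (mu p <= i)%N -> e p *m mxpow B i = 0.
  by move=> /subnKC <-; rewrite mxpowD mulmxA eB mul0mx.
have wB j : w j *m mxpow B (la j) = 0.
  have [le1 le2] := inter j.
  rewrite mulmxDl -mulmxA -mxpowD (e0 (_.+1)) // e0 ?addr0 //; lia.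
have [H [HB uH]] := hom_of_generators lam ugen uA wB.
exists H; split=> // J.
have wH j i : (w j *m mxpow B i <= H)%MS.
  by rewrite -uH -mulmxA (mxpow_intertwine i HB) mulmxA submxMl.
(* The generators that survive in the cokernel; by [fH] the order of [f p] there is at most
   [ga p]. *)
pose f p := e (if (p < t)%N then p else (t + 2 * (p - t))%N).
have fH p i : (ga p <= i)%N -> (f p *m mxpow B i <= H)%MS.
  move=> /subnKC <-; rewrite /ga /f /diffp; case: ltnP => pt.
    by rewrite mxpowD mulmxA eB mul0mx sub0mx.
  set j := (p - t)%N; have [le1 le2] := inter j.
  have -> : (mu (t + 2 * j) + mu (t + 2 * j).+1 - la j =
     (mu (t + 2 * j) - la j) + mu (t + 2 * j).+1)%N by lia.
  rewrite -addnA mxpowD mulmxA.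
  have -> : e (t + 2 * j)%N *m mxpow B (mu (t + 2 * j) - la j)%N
     = w j - e (t + 2 * j)%N.+1 by rewrite /w addrK.
  by rewrite mulmxBl (e0 (_.+1)) ?leq_addr // subr0.
(* What each [f p] can still contribute modulo [H] and the image of [mxpow B J]. *)
pose K := (\sum_(p < M) \sum_(i < minn J (ga p)) <<f p *m mxpow B i>>)%MS.
pose U := (col_mx (mxpow B J) H + K)%MS.
have rkU : (\rank U <= \rank (col_mx (mxpow B J) H) + \sum_(p < M) minn J (ga p))%N.
  apply: leq_trans (_ : \rank (col_mx (mxpow B J) H) + \rank K <= _)%N.
    by rewrite mxrank_adds_leqif.
  rewrite leq_add2l; apply: leq_trans (mxrank_sums_le _ _ _) _.
  apply: leq_sum => p _; apply: leq_trans (mxrank_sums_le _ _ _) _.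
  rewrite -[X in (_ <= X)%N]card_ord -sum1_card; apply: leq_sum => i _.
  by rewrite genmxE rank_leq_row.
apply: leq_trans rkU; suff /eqP -> : row_full U by [].
have HU : (H <= U)%MS.
  by apply: submx_trans (addsmxSl _ _); rewrite -addsmxE addsmxSr.
have fU p i : (f p *m mxpow B i <= U)%MS.
  case: (leqP J i) => [Ji|iJ].
    apply: submx_trans (addsmxSl _ _); rewrite -addsmxE.
    by apply: submx_trans (addsmxSl _ _); rewrite -(subnK Ji) mxpowD mulmxA submxMl.
  case: (leqP (ga p) i) => [gi|ig]; first exact: submx_trans (fH _ _ gi) HU.
  have pM : (p < M)%N by rewrite ltnNge; apply/negP => /ga0 p0; rewrite /ga p0 in ig.
  apply: submx_trans (addsmxSr _ _); apply: (sumsmx_sup (Ordinal pM)) => //.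
  have im : (i < minn J (ga p))%N by rewrite leq_min iJ ig.
  by apply: (sumsmx_sup (Ordinal im)) => //; rewrite genmxE.
apply: egen => q i.
case: (ltnP q t) => qt; first by have := fU q i; rewrite /f qt.
have evU j i' : (e (t + 2 * j)%N *m mxpow B i' <= U)%MS.
  by have := fU (t + j)%N i'; rewrite /f ltnNge leq_addr /= addKn.
have [j [->|->]] : exists j, q = (t + 2 * j)%N \/ q = (t + 2 * j)%N.+1.
  by exists ((q - t) %/ 2)%N; lia.
- exact: evU.
have -> : e (t + 2 * j)%N.+1 = w j - e (t + 2 * j)%N *m mxpow B (mu (t + 2 * j) - la j)%N.
  by rewrite /w [X in X - _]addrC addrK.
rewrite mulmxBl addmx_sub ?(submx_trans (wH _ _) HU) // eqmx_opp.
by rewrite -mulmxA -mxpowD.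
Qed.

End ExplicitHom.
(** * The sum of the spaces at the heads of the arrows out of [k] *)

Section AdjacentPartition.
Variables (n : nat) (Q : quiver n) (d : 'I_n -> nat) (k : 'I_n).
Variable nu : 'I_n -> nat -> nat.

Definition adjseq : seq nat := sort geq [seq x <- flatten
  [seq [seq nu (qtgt Q a) q | q <- iota 0 (d (qtgt Q a))]
  | a <- enum 'I_(qm Q) & qsrc Q a == k] | (0 < x)%N].

Lemma adjpart_mono p : (adjpart Q d nu k p.+1 <= adjpart Q d nu k p)%N.
Proof.
rewrite /adjpart -/adjseq; case: (ltnP p.+1 (size adjseq)) => ps; last by rewrite nth_default.
have srt : sorted geq adjseq by apply: sort_sorted => x y; rewrite /geq /=; apply: leq_total.
by have /(sortedP 0%N) := srt; apply.
Qed.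

Lemma adjpart_tail p : (size adjseq <= p)%N -> adjpart Q d nu k p = 0%N.
Proof. by move=> sp; rewrite /adjpart -/adjseq nth_default. Qed.

(** The excess depends neither on the order of the parts nor on zero parts, so sorting and filtering
    drop out. *)
Lemma excess_adjpart J : excess (size adjseq) (adjpart Q d nu k) J =
  (\sum_(a | qsrc Q a == k) excess (d (qtgt Q a)) (nu (qtgt Q a)) J)%N.
Proof.
rewrite /excess /adjpart -/adjseq.
rewrite -(big_mkord xpredT (fun p => nth 0%N adjseq p - J)%N).
rewrite -(big_nth 0%N xpredT (fun x => x - J)%N) /adjseq.
rewrite (perm_big _ (permEl (perm_sort _ _))) /= big_filter.
rewrite (_ : (\sum_(i <- _ | _) _)%N = (\sum_(i <- flatten
  [seq [seq nu (qtgt Q a) q | q <- iota 0 (d (qtgt Q a))]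
  | a <- enum 'I_(qm Q) & qsrc Q a == k]) (i - J))%N); last first.
  rewrite big_mkcond /=; apply: eq_bigr => i _; by case: i.
rewrite big_flatten big_map big_filter big_enum_cond /=.
apply: eq_bigr => a _; rewrite big_map -[X in iota _ X]subn0 -/(index_iota 0 _).
by rewrite big_mkord.
Qed.

End AdjacentPartition.

Section OutSum.
Variables (F : fieldType) (n : nat) (Q : quiver n) (d : 'I_n -> nat) (k : 'I_n).
Variables (D : nat) (R : forall a : 'I_(qm Q), 'M[F]_(d (qtgt Q a), D))
  (S : forall a : 'I_(qm Q), 'M[F]_(D, d (qtgt Q a))).
Hypotheses (RS1 : forall a, qsrc Q a == k -> R a *m S a = 1%:M)
  (RS0 : forall a b, a != b -> R a *m S b = 0)
  (SR1 : \sum_(a | qsrc Q a == k) S a *m R a = 1%:M).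
Implicit Types (X V : rep F Q d) (N P : forall i, 'M[F]_(d i)).

(** In the coordinates of [W] given by [R] and [S], [hmap] is the map from the space at [k] to [W],
    [wmap] the diagonal action on [W], and [gmap] the map from [W] to [C]. *)
Definition hmap X : 'M[F]_(d k, D) := \sum_(a | qsrc Q a == k) outk X k a *m R a.

Definition wmap N : 'M[F]_D :=
  \sum_(a | qsrc Q a == k) S a *m N (qtgt Q a) *m R a.

Definition gmap c (g : forall a : 'I_(qm Q), 'M[F]_(d (qtgt Q a), c)) : 'M[F]_(D, c) :=
  \sum_(a | qsrc Q a == k) S a *m g a.

Lemma out_sum_mulS m (Y : forall a, 'M[F]_(m, d (qtgt Q a))) a : qsrc Q a == k ->
  (\sum_(b | qsrc Q b == k) Y b *m R b) *m S a = Y a.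
Proof.
move=> ak; rewrite mulmx_suml (bigD1 a) //= -mulmxA RS1 // mulmx1 big1 ?addr0 //.
by move=> b /andP[_ ba]; rewrite -mulmxA RS0 // mulmx0.
Qed.

Lemma out_mulR_sum m (Y : forall a, 'M[F]_(d (qtgt Q a), m)) a : qsrc Q a == k ->
  R a *m (\sum_(b | qsrc Q b == k) S b *m Y b) = Y a.
Proof.
move=> ak; rewrite mulmx_sumr (bigD1 a) //= mulmxA RS1 // mul1mx big1 ?addr0 //.
by move=> b /andP[_ ba]; rewrite mulmxA RS0 ?mul0mx // eq_sym.
Qed.

Lemma mulR_wmap N a : qsrc Q a == k -> R a *m wmap N = N (qtgt Q a) *m R a.
Proof.
move=> ak; rewrite /wmap -(out_mulR_sum (fun b => N (qtgt Q b) *m R b) ak).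
by congr (_ *m _); apply: eq_bigr => b _; rewrite mulmxA.
Qed.

Lemma wmap_mulS N a : qsrc Q a == k -> wmap N *m S a = S a *m N (qtgt Q a).
Proof. by move=> ak; rewrite /wmap (out_sum_mulS (fun b => S b *m N (qtgt Q b))). Qed.

Lemma wmapM N P : wmap N *m wmap P = wmap (fun i => N i *m P i).
Proof.
rewrite {2}/wmap mulmx_sumr; apply: eq_bigr => a ak.
by rewrite !mulmxA wmap_mulS.
Qed.

Lemma wmap1 : wmap (fun i => 1%:M) = 1%:M.
Proof. by rewrite -SR1; apply: eq_bigr => a _; rewrite mulmx1. Qed.

Lemma wmap_pow N e : mxpow (wmap N) e = wmap (fun i => mxpow (N i) e).
Proof. by elim: e => [|e IH]; rewrite ?wmap1 // mxpowS IH wmapM. Qed.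

Lemma wmap_unit N : (forall i, N i \in unitmx) -> wmap N \in unitmx.
Proof.
move=> Nu; have [] // := @mulmx1_unit _ _ (wmap N) (wmap (fun i => invmx (N i))).
by rewrite wmapM -wmap1; apply: eq_bigr => a _; rewrite mulmxV.
Qed.

Lemma wmap_rank N : (\rank (wmap N) <= \sum_(a | qsrc Q a == k) \rank (N (qtgt Q a)))%N.
Proof.
rewrite /wmap; elim/big_ind2: _ => [|A a B b Aa Bb|a _]; first by rewrite mxrank0.
  exact: leq_trans (mxrank_add _ _) (leq_add Aa Bb).
exact: leq_trans (mxrankM_maxl _ _) (mxrankM_maxr _ _).
Qed.

Lemma wmap_nilp N : (forall a, qsrc Q a == k -> nilp (N (qtgt Q a))) -> nilp (wmap N).
Proof.
move=> nN; exists (\max_i d i); rewrite wmap_pow /wmap big1 // => a ak.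
by rewrite nilp_mxpow_size ?mulmx0 ?mul0mx //; [exact: nN|exact: leq_bigmax].
Qed.

Lemma wmap_lin N P x y :
  wmap (fun i => x *: N i + y *: P i) = x *: wmap N + y *: wmap P.
Proof.
rewrite /wmap !scaler_sumr -big_split /=; apply: eq_bigr => a _.
by rewrite mulmxDr mulmxDl -!scalemxAr -!scalemxAl.
Qed.

Lemma hmap_lin X V x y :
  hmap (fun a => x *: X a + y *: V a) = x *: hmap X + y *: hmap V.
Proof.
rewrite /hmap !scaler_sumr -big_split /=; apply: eq_bigr => a _.
by rewrite outk_lin mulmxDl -!scalemxAl.
Qed.

Lemma hmap_mulS X a : qsrc Q a == k -> hmap X *m S a = outk X k a.
Proof. exact: (out_sum_mulS (outk X k)). Qed.

Lemma hmap_wmap X V P :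
  (forall a, qsrc Q a == k -> X a *m P (qtgt Q a) = P (qsrc Q a) *m V a) <->
  hmap X *m wmap P = P k *m hmap V.
Proof.
split=> [XP|HP a ak].
  rewrite /hmap mulmx_suml mulmx_sumr; apply: eq_bigr => a ak.
  by rewrite -mulmxA mulR_wmap // !mulmxA; congr (_ *m _); apply/outk_intertwine/XP.
apply/(outk_intertwine _ _ _ _ ak).
by rewrite -hmap_mulS // -mulmxA -wmap_mulS // mulmxA HP -mulmxA hmap_mulS.
Qed.

Lemma gmap_wmap c (g : forall a : 'I_(qm Q), 'M[F]_(d (qtgt Q a), c)) N Nk :
  (forall a, qsrc Q a == k -> g a *m Nk = N (qtgt Q a) *m g a) <->
  gmap g *m Nk = wmap N *m gmap g.
Proof.
split=> [gN|GN a ak].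
  rewrite /gmap mulmx_suml mulmx_sumr; apply: eq_bigr => a ak.
  by rewrite mulmxA wmap_mulS // -!mulmxA gN.
have gE : R a *m gmap g = g a by apply: (out_mulR_sum g).
by rewrite -gE -mulmxA GN mulmxA mulR_wmap // mulmxA.
Qed.

Lemma gmap_cokernel V c (g : forall a : 'I_(qm Q), 'M[F]_(d (qtgt Q a), c)) :
  is_cokernel V k g ->
  [/\ hmap V *m gmap g = 0, row_full (gmap g) & (kermx (gmap g) <= hmap V)%MS].
Proof.
have yG m (y : 'M[F]_(m, D)) :
    y *m gmap g = \sum_(a | qsrc Q a == k) (y *m S a) *m g a.
  by rewrite /gmap mulmx_sumr; apply: eq_bigr => a _; rewrite mulmxA.
move=> [c1 c2 c3]; split.
- rewrite yG -[RHS]c1; apply: eq_bigr => a ak; by rewrite hmap_mulS.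
- rewrite -sub1mx; apply/row_subP => i.
  have [y ->] := c2 (row i 1%:M); apply/submxP.
  exists (\sum_(a | qsrc Q a == k) y a *m R a).
  by rewrite yG; apply: eq_bigr => a ak; rewrite out_sum_mulS.
- apply/row_subP => i; set y := row i _.
  have yG0 : y *m gmap g = 0.
    by apply/sub_kermxP; rewrite row_sub.
  have [x xE] := c3 (fun a => y *m S a) ltac:(by rewrite -yG).
  apply/submxP; exists x; rewrite -[y]mulmx1 -SR1 mulmx_sumr /hmap mulmx_sumr.
  by apply: eq_bigr => a ak; rewrite !mulmxA xE.
Qed.

(** The generators of the summands are sorted together with their orders, which matches them with
    the parts of [adjpart]. *)
Lemma wmap_generators N nu : (forall i, nilp (N i)) ->
  (forall i p, jtype (N i) p = nu i p) ->
  exists e : nat -> 'rV[F]_D, generates (wmap N) e /\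
    forall p, e p *m mxpow (wmap N) (adjpart Q d nu k p) = 0.
Proof.
move=> nN Nnu.
have [v vP] : exists v : forall i, nat -> 'rV[F]_(d i), forall i,
    (forall p, v i p *m mxpow (N i) (nu i p) = 0) /\ generates (N i) (v i).
  apply: (fin_all_exists (P := fun i (v : nat -> 'rV[F]_(d i)) =>
    (forall p, v p *m mxpow (N i) (nu i p) = 0) /\ generates (N i) v)) => i.
  have [v [v0 vgen]] := jtype_generators (nN i); exists v; split=> // p.
  by rewrite -Nnu.
pose L := flatten [seq [seq (v (qtgt Q a) q *m R a, nu (qtgt Q a) q)
    | q <- iota 0 (d (qtgt Q a))] | a <- enum 'I_(qm Q) & qsrc Q a == k].
pose s := sort (relpre snd geq) [seq z <- L | (0 < z.2)%N].
have sE : map snd s = adjseq Q d k nu.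
  rewrite /s -sort_map /adjseq; congr sort.
  rewrite -(filter_map snd (fun x => (0 < x)%N)) map_flatten -map_comp.
  congr filter; congr flatten; apply: eq_map => a /=; rewrite -map_comp.
  exact: eq_map.
have Lmem z : z \in L -> exists2 a, qsrc Q a == k &
    exists2 q, (q < d (qtgt Q a))%N & z = (v (qtgt Q a) q *m R a, nu (qtgt Q a) q).
  move=> /flatten_mapP[a]; rewrite mem_filter => /andP[ak _] /mapP[q].
  by rewrite mem_iota => /andP[_ qd] ->; exists a => //; exists q.
pose e p := (nth (0 : 'rV[F]_D, 0%N) s p).1.
have muE p : adjpart Q d nu k p = (nth (0 : 'rV[F]_D, 0%N) s p).2.
  rewrite /adjpart -/(adjseq Q d k nu) -sE; case: (ltnP p (size s)) => ps.
    by rewrite (nth_map (0 : 'rV[F]_D, 0%N)).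
  by rewrite !nth_default // size_map.
have vR a q i : qsrc Q a == k ->
    v (qtgt Q a) q *m R a *m mxpow (wmap N) i = v (qtgt Q a) q *m mxpow (N (qtgt Q a)) i *m R a.
  by move=> ak; rewrite -mulmxA (mxpow_intertwine i (mulR_wmap N ak)) mulmxA.
exists e; split; last first.
  move=> p; rewrite muE /e; case: (ltnP p (size s)) => ps; last first.
    by rewrite nth_default // mul0mx.
  have := mem_nth (0 : 'rV[F]_D, 0%N) ps; rewrite mem_sort mem_filter => /andP[_].
  move=> /Lmem[a ak [q _ ->]] /=.
  by rewrite vR // (vP _).1 mul0mx.
move=> U eU; rewrite -sub1mx -SR1; apply: summx_sub => a ak; apply: mulmx_sub.
have /(vP (qtgt Q a)).2 : forall q i,
    (v (qtgt Q a) q *m mxpow (N (qtgt Q a)) i <= kermx (R a *m cokermx U))%MS.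
  move=> q i; apply/sub_kermxP; rewrite [LHS]mulmxA -vR //; apply/eqP; rewrite -submxE.
  (* A generator of order zero is missing from [s], but it is the zero vector. *)
  case: (posnP (nu (qtgt Q a) q)) => [q0|q0].
    have := (vP (qtgt Q a)).1 q; rewrite q0 mulmx1 => ->.
    by rewrite !mul0mx sub0mx.
  have qd : (q < d (qtgt Q a))%N.
    by rewrite ltnNge; apply/negP => qd; move: q0; rewrite -Nnu jtype_tail.
  have zs : (v (qtgt Q a) q *m R a, nu (qtgt Q a) q) \in s.
    rewrite mem_sort mem_filter /= q0; apply/flatten_mapP; exists a.
      by rewrite mem_filter ak mem_enum.
    by apply/mapP; exists q => //; rewrite mem_iota.
  have := eU (index (v (qtgt Q a) q *m R a, nu (qtgt Q a) q) s) i.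
  by rewrite /e nth_index.
rewrite -sub1mx => /sub_kermxP; rewrite mul1mx => /eqP.
by rewrite -submxE.
Qed.

End OutSum.
(** * Nilpotent endomorphisms *)

Section NilEndoConjugacy.
Variables (F : closedFieldType) (n : nat) (Q : quiver n) (d : 'I_n -> nat).
Variable V : rep F Q d.

Definition is_endo (N : forall i, 'M[F]_(d i)) : Prop :=
  forall a, V a *m N (qtgt Q a) = N (qsrc Q a) *m V a.

Lemma is_endo_lin N P x y : is_endo N -> is_endo P -> is_endo (fun i => x *: N i + y *: P i).
Proof.
by move=> eN eP a; rewrite mulmxDr mulmxDl -!scalemxAr -!scalemxAl eN eP.
Qed.

Lemma is_endo_mul N P : is_endo N -> is_endo P -> is_endo (fun i => N i *m P i).
Proof. by move=> eN eP a; rewrite mulmxA eN -!mulmxA eP. Qed.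

Lemma is_endo1 : is_endo (fun i => 1%:M).
Proof. by move=> a; rewrite mulmx1 mul1mx. Qed.

(** [rep_nil_conj] for the endomorphism algebra of [V], acting diagonally on the sum of the spaces
    at all vertices. *)
Lemma nil_endo_conj N N' : nil_endo V N -> nil_endo V N' ->
  exists u v, [/\ is_endo u, is_endo v, forall i, u i *m v i = 1%:M &
    forall x y i, nilp (x *: (u i *m N i *m v i) + y *: N' i)].
Proof.
move=> [nN eN] [nN' eN'].
have [D [R [S [RS1 RS0 SR1 _]]]] := biproduct F xpredT d.
pose T := {P | is_endo P}.
pose tadd (x y : T) : T := exist _ _ (is_endo_lin 1 1 (svalP x) (svalP y)).
pose tscale a (x : T) : T := exist _ _ (is_endo_lin a 0 (svalP x) (svalP x)).
pose tmul (x y : T) : T := exist _ _ (is_endo_mul (svalP x) (svalP y)).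
pose tone : T := exist _ _ is_endo1.
pose rho (z : T) := \sum_i S i *m sval z i *m R i.
have Rrho z i : R i *m rho z = sval z i *m R i.
  rewrite mulmx_sumr (bigD1 i) //= !mulmxA RS1 // mul1mx big1 ?addr0 //.
  by move=> j ji; rewrite !mulmxA RS0 ?mul0mx // eq_sym.
have rhoM x y : rho (tmul x y) = rho x *m rho y.
  by rewrite [in RHS]/rho mulmx_suml; apply: eq_bigr => i _; rewrite -!mulmxA Rrho.
have rrep : is_rep tadd tmul tscale tone rho.
  split=> // [x y|a x|].
  - rewrite /rho -big_split /=; apply: eq_bigr => i _.
    by rewrite !scale1r mulmxDr mulmxDl.
  - rewrite /rho scaler_sumr; apply: eq_bigr => i _ /=.
    by rewrite scale0r addr0 -scalemxAr -scalemxAl.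
  - by rewrite -SR1; apply: eq_bigr => i _; rewrite mulmx1.
have nrho z : (forall i, nilp (sval z i)) -> nilp (rho z).
  move=> nz; exists (\max_i d i); rewrite -(rep_tpow z _ rrep) /rho big1 // => i _.
  have -> : sval (tpow tmul tone z (\max_i d i)) i = mxpow (sval z i) (\max_i d i).
    by elim: (\max_i d i) => //= e ->.
  by rewrite nilp_mxpow_size ?mulmx0 ?mul0mx //; apply: leq_bigmax.
have Rf i : row_free (R i) by apply/row_freeP; exists (S i); apply: RS1.
have [u [v [uv nil]]] := rep_nil_conj rrep (nrho (exist _ N eN) nN)
  (nrho (exist _ N' eN') nN').
exists (sval u), (sval v); split=> [||i|x y i]; try exact: svalP.
  have := congr1 (fun A => R i *m A *m S i) uv.
  rewrite mulmx1 RS1 // mulmxA Rrho -(mulmxA _ (R i)) Rrho mulmxA -mulmxA RS1 //.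
  by rewrite mulmx1.
apply: nilp_row_free (Rf i) _ (nil x y).
rewrite mulmxDr mulmxDl -!scalemxAr -!scalemxAl Rrho !mulmxA Rrho.
by rewrite -(mulmxA _ (R i)) Rrho mulmxA -(mulmxA _ (R i)) Rrho mulmxA.
Qed.

End NilEndoConjugacy.

(** * Generic compatible representations and their endomorphisms *)

Section PolyLine.
Variables (F : closedFieldType) (n : nat) (Q : quiver n) (d : 'I_n -> nat).

Lemma polyfun_ext (f : rep F Q d -> F) X Y : polyfun f -> (forall a, X a = Y a) -> f X = f Y.
Proof.
move=> + XY; elim=> [c|a i j|f1 g1 _ IHf _ IHg|f1 g1 _ IHf _ IHg] //.
- by rewrite XY.
- by rewrite IHf IHg.
- by rewrite IHf IHg.
Qed.

Lemma polyfun_line (f : rep F Q d -> F) (X Y : rep F Q d) : polyfun f ->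
  polyc (fun s => f (fun a => (1 - s) *: X a + s *: Y a)).
Proof.
elim=> [c|a i j|f1 g1 _ IHf _ IHg|f1 g1 _ IHf _ IHg].
- exact: polyc_const.
- exact: (polymx_line (X a) (Y a)).
- exact: polyc_add.
- exact: polyc_mul.
Qed.

End PolyLine.

Section Reflection.
Variables (F : closedFieldType) (n : nat) (Q : quiver n) (d : 'I_n -> nat).
Variables (V : rep F Q d) (k : 'I_n) (nu : 'I_n -> nat -> nat) (t : nat).
Variables (D : nat) (R : forall a : 'I_(qm Q), 'M[F]_(d (qtgt Q a), D))
  (S : forall a : 'I_(qm Q), 'M[F]_(D, d (qtgt Q a))).
Hypotheses (RS1 : forall a, qsrc Q a == k -> R a *m S a = 1%:M)
  (RS0 : forall a b, a != b -> R a *m S b = 0)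
  (SR1 : \sum_(a | qsrc Q a == k) S a *m R a = 1%:M)
  (DE : (D = \sum_(a | qsrc Q a == k) d (qtgt Q a))%N).
Hypotheses (part : forall i, partition_of (nu i) (d i))
  (inter : interlaced t (adjpart Q d nu k) (nu k)).

Local Notation mu := (adjpart Q d nu k).
Local Notation ga := (diffp t mu (nu k)).
Local Notation size_mu := (size (adjseq Q d k nu)).
Local Notation hmap := (hmap k R).
Local Notation wmap := (wmap k R S).

(** By [diffp_sum] the size of [ga] is that of [mu] minus that of [nu k]; the size of [mu] is its
    excess at zero, which is additive over the arrows. *)
Lemma diff_sum M : (size_mu <= M)%N -> (d k <= M)%N ->
  (\sum_(p < t + M) ga p + d k = D)%N.
Proof.
move=> sM dM; have [_ la0 lasum] := part k.
have := diffp_sum inter M; rewrite (sum_widen la0 dM) lasum => ->.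
have mu0 p := @adjpart_tail _ Q d k nu p.
rewrite (sum_widen (M := size_mu) mu0); last by lia.
have excess0 m la : excess m la 0%N = (\sum_(p < m) la p)%N.
  by apply: eq_bigr => p _; rewrite subn0.
rewrite DE -excess0 excess_adjpart; apply: eq_bigr => a _.
by rewrite excess0; have [_ _ ->] := part (qtgt Q a).
Qed.

Lemma nil_endo_wmap_rank N M J : nil_endo V N ->
  (forall i, dominated (jtype (N i)) (nu i)) -> (size_mu <= M)%N ->
  (\rank (mxpow (wmap N) J) <= excess M mu J)%N.
Proof.
move=> [nN _] dom sM.
rewrite (excess_widen _ (@adjpart_tail _ Q d k nu) sM) excess_adjpart.
rewrite wmap_pow //; apply: leq_trans (wmap_rank _ _ _ _) _.
apply: leq_sum => a _; have [_ nu0 _] := part (qtgt Q a).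
rewrite -(excess_jtype J (nN _) (leqnn _)).
apply: dominated_excess => //; [exact: jtype_mono|exact: jtype_tail].
Qed.

(* [D - d k] is the size of [ga], so the last clause bounds the ranks of the
   powers of the map induced on the cokernel from below. *)
Lemma generic_nil_endo M : (size_mu <= M)%N -> (d k <= M)%N -> isGenRep V nu ->
  exists N, [/\ nil_endo V N, forall i p, jtype (N i) p = nu i p, row_free (hmap V) &
    forall J, (excess (t + M) ga J + d k <= \rank (col_mx (mxpow (wmap N) J) (hmap V)))%N].
Proof.
move=> sM dM [N [Nnu [f [fpoly [X0 [cX0 fX0]] fiso]]]].
have nN i := (Nnu i).1; have tN i := (Nnu i).2.
have [e [egen eB]] := wmap_generators RS1 RS0 SR1 nN tN.
have [u [u0 ugen]] := jtype_generators (nN k).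
have {}u0 p : u p *m mxpow (N k) (nu k p) = 0 by rewrite -tN.
have mu0 p := @adjpart_tail _ Q d k nu p.
have ga0 p : (t + M <= p)%N -> ga p = 0%N by apply: diffp_tail => q qM; apply: mu0; lia.
have [H1 [H1B H1rk]] := interlaced_hom (part k) ugen u0 egen eB inter ga0.
have [X1 [X1k X10]] := rep_of_outk (fun a => H1 *m S a).
have hX1 : hmap X1 = H1.
  rewrite -[RHS]mulmx1 -SR1 mulmx_sumr; apply: eq_bigr => a ak.
  by rewrite X1k // mulmxA.
have cX1 : compatible N X1.
  move=> a; case: (boolP (qsrc Q a == k)) => ak; last by rewrite X10 // mul0mx mulmx0.
  have /(hmap_wmap RS1 RS0) : hmap X1 *m wmap N = N k *m hmap X1 by rewrite hX1.
  exact.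
(* On this line of compatible representations, [s = 0] shows that the generic point is isomorphic to
   [V], and [s = 1] that its ranks are at least those of [H1]. *)
pose X s : rep F Q d := fun a => (1 - s) *: X0 a + s *: X1 a.
have cX s : compatible N (X s).
  by move=> a; rewrite /X mulmxDl mulmxDr -!scalemxAl -!scalemxAr cX0 cX1.
have gf : generic (fun s => f (X s) != 0).
  apply: (generic_polyc (s0 := 0)) (polyfun_line X0 X1 fpoly) _.
  rewrite (polyfun_ext (Y := X0) fpoly) // => a.
  by rewrite subr0 scale1r scale0r addr0.
have hX s : hmap (X s) = (1 - s) *: hmap X0 + s *: hmap X1 by rewrite hmap_lin.
(* Only finitely many conditions can be imposed at once; the exponents up to [D] suffice, since the
   power [D] is already zero. *)
have gr : generic (fun s => forall J : 'I_D.+1,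
    \rank (col_mx (mxpow (wmap N) J) H1) <= \rank (col_mx (mxpow (wmap N) J) (hmap (X s))))%N.
  apply: generic_all => J.
  have -> : H1 = hmap (X 1) by rewrite hX hX1 subrr scale0r scale1r add0r.
  apply: (generic_rank (f := fun s => col_mx (mxpow (wmap N) J) (hmap (X s)))).
  apply: polymx_col; first exact: polymx_const.
  move=> i j; apply: polyc_ext (polymx_line (hmap X0) (hmap X1) i j) => s.
  by rewrite hX.
have [s [fs rs]] := generic_ex (generic_and gf gr).
have [P [Pu XP]] := fiso _ (cX s) fs.
(* [N] is transported to [V] along the isomorphism [P]. *)
pose N0 i := invmx (P i) *m N i *m P i.
have PN i : P i *m N0 i = N i *m P i by rewrite /N0 !mulmxA mulmxV // mul1mx.
have VE a : V a = invmx (P (qsrc Q a)) *m X s a *m P (qtgt Q a).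
  by rewrite -mulmxA XP mulKmx.
have rkN i j : \rank (mxpow (N0 i) j) = \rank (mxpow (N i) j).
  by rewrite (mxrank_mxpow_conj j (Pu i) (PN i)).
have rkcol J : \rank (col_mx (mxpow (wmap N0) J) (hmap V)) =
    \rank (col_mx (mxpow (wmap N) J) (hmap (X s))).
  have wPu : wmap P \in unitmx by apply: wmap_unit.
  have wPN : wmap P *m wmap N0 = wmap N *m wmap P.
    by rewrite !wmapM //; apply: eq_bigr => a _; rewrite PN.
  rewrite -[RHS](mxrankMfree _ (B := wmap P)) ?row_free_unit // mul_col_mx.
  rewrite -(mxpow_intertwine J wPN).
  have -> : hmap (X s) *m wmap P = P k *m hmap V by apply/hmap_wmap.
  rewrite -!addsmxE.
  have e1 : (wmap P *m mxpow (wmap N0) J :=: mxpow (wmap N0) J)%MS.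
    by apply: eqmxMfull; rewrite row_full_unit.
  have e2 : (P k *m hmap V :=: hmap V)%MS by apply: eqmxMfull; rewrite row_full_unit.
  by rewrite (adds_eqmx e1 e2).
have bound (J : 'I_D.+1) :
    (excess (t + M) ga J + d k <= \rank (col_mx (mxpow (wmap N0) J) (hmap V)))%N.
  rewrite rkcol; apply: leq_trans (rs J).
  have := H1rk J; have := diff_sum sM dM.
  have -> : (\sum_(p < t + M) ga p =
      \sum_(p < t + M) minn J (ga p) + excess (t + M) ga J)%N.
    by rewrite /excess -big_split /=; apply: eq_bigr => p _; lia.
  by move: (\sum_(p < t + M) minn J (ga p))%N => x; lia.
have nN0 i : nilp (N0 i).
  by apply: nilp_row_full (nN i); [rewrite row_full_unit; apply: Pu|apply: PN].
have Vfree : row_free (hmap V).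
  rewrite /row_free eqn_leq rank_leq_row /=.
  (* At [J = D] the power vanishes and only the rank of [hmap V] is left. *)
  have := bound ord_max; rewrite /= nilp_mxpow_size //; last exact: wmap_nilp.
  rewrite -addsmxE adds0mx; apply: leq_trans; exact: leq_addl.
exists N0; split=> //.
- split=> // a; rewrite [in LHS]VE [in RHS]VE -!mulmxA PN (mulmxA (X s a)) cX.
  by rewrite /N0 -!mulmxA (mulmxA (P _) (invmx _)) mulmxV // mul1mx.
- move=> i p; rewrite -tN !jtypeE; apply: eq_bigr => j _.
  by rewrite !rkN.
move=> J; case: (ltnP J D.+1) => JD; first exact: (bound (Ordinal JD)).
(* No part of [ga] exceeds [D]; injectivity of [hmap V] alone then gives the bound. *)
have -> : excess (t + M) ga J = 0%N.
  rewrite /excess big1 // => p _; apply/eqP; rewrite subn_eq0.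
  apply: leq_trans (ltnW JD); rewrite -(diff_sum sM dM) (bigD1 p) //= -addnA.
  exact: leq_addr.
rewrite add0n -{1}(eqP Vfree) -addsmxE; apply: mxrankS; exact: addsmxSr.
Qed.

End Reflection.

(** * The generic Jordan type of the reflected representation *)

Theorem theorem3p7 (F : closedFieldType) (n : nat) (Q : quiver n)
  (d : 'I_n -> nat) (V : rep F Q d) (k : 'I_n) (nu : 'I_n -> nat -> nat)
  (t : nat) :
  dynkin Q -> is_source Q k ->
  (forall i, partition_of (nu i) (d i)) ->
  interlaced t (adjpart Q d nu k) (nu k) ->
  isGenRep V nu -> isGenJF V nu ->
  forall (c : nat) (g : forall a : 'I_(qm Q), 'M[F]_(d (qtgt Q a), c)),
    is_cokernel V k g ->
    isGenJF_refl V k g (sigma_nu Q d t nu k).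
Proof.
move=> _ srck part inter genrep [_ maxV] c g cok.
have [D [R [S [RS1 RS0 SR1 DE]]]] :=
  biproduct F (fun a => qsrc Q a == k) (fun a => d (qtgt Q a)).
pose mu := adjpart Q d nu k; pose ga := diffp t mu (nu k).
pose h := hmap k R V; pose G := gmap k S g; pose W := wmap k R S.
have [hG Gfull kerG] := gmap_cokernel RS1 RS0 SR1 cok; rewrite -/h -/G in hG Gfull kerG.
(* A common bound for the numbers of parts of [mu], of [nu k] and of the types on the cokernel; [ga]
   is bounded by [t + M]. *)
pose M := (size (adjseq Q d k nu) + d k + c)%N.
have sM : (size (adjseq Q d k nu) <= M)%N by rewrite /M; lia.
have dM : (d k <= M)%N by rewrite /M; lia.
have cM : (c <= M)%N by rewrite /M; lia.
have mu_mono := adjpart_mono Q d k nu.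
have mu0 p : (M <= p)%N -> mu p = 0%N by move=> Mp; apply: adjpart_tail; lia.
have [_ la0 _] := part k.
have [N0 [nN0 tN0 hfree lowN0]] :=
  generic_nil_endo RS1 RS0 SR1 DE part inter sM dM genrep.
rewrite -/h in hfree; rewrite -/h -/(W N0) -/mu -/ga in lowN0.
have hW N : is_endo V N -> h *m W N = N k *m h.
  by move=> eN; apply/(hmap_wmap RS1 RS0) => a _; apply: eN.
have rkN0 J : excess M (nu k) J = \rank (mxpow (N0 k) J).
  rewrite -(excess_jtype J (nN0.1 k) dM).
  by apply: eq_bigr => p _; rewrite tN0.
(* [Nk] need not be induced by [N]: it is compared with the induced map [B], while [N] is compared
   with [N0] at [k]. *)
have dom_ga (Nk : 'M[F]_c) N B : nilp Nk -> nil_endo V N -> G *m B = W N *m G ->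
    (forall J, \rank (mxpow (N0 k) J) <= \rank (mxpow (N k) J))%N ->
    (forall J, \rank (mxpow Nk J) <= \rank (mxpow B J))%N -> dominated (jtype Nk) ga.
  move=> nNk eN GB leN leB; apply: (@dominated_diffp _ _ _ mu_mono inter M) => //.
    by move=> p Mp; apply: jtype_tail; lia.
  move=> J; rewrite (excess_jtype J nNk cM) rkN0.
  apply: leq_trans (leq_add (leB J) (leN J)) _.
  apply: leq_trans (cokernel_rank_add hG Gfull J hfree GB (hW _ eN.2)) _.
  exact: (nil_endo_wmap_rank RS1 RS0 SR1 part J eN (maxV _ eN) sM).
have ga_mono := diffp_mono mu_mono inter.
have ga0 p : (t + M <= p)%N -> ga p = 0%N by apply: diffp_tail.
split.
  (* The maximum is attained by the map that [N0] induces; [dom_ga] bounds its type above and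
     [lowN0] below. *)
  have [B GB] := cokernel_induced hG Gfull kerG (hW _ nN0.2).
  have nB : nilp B.
    apply: nilp_row_full Gfull GB _; apply: (wmap_nilp RS1 RS0 SR1) => a _.
    exact: nN0.1.
  have Bga : jtype B =1 ga.
    apply: dominated_anti; first exact: dom_ga nB nN0 GB _ _.
    apply: (@excess_dominated (t + M)) => //; first exact: jtype_mono.
      by move=> p Mp; apply: jtype_tail; lia.
    move=> J; rewrite (excess_jtype J nB); last by lia.
    rewrite -(leq_add2r (\rank h)) (cokernel_rank hG Gfull kerG J GB) (eqP hfree).
    exact: lowN0.
  exists N0, B; split.
    split=> [i _||a _|]; [exact: nN0.1|exact: nB|exact: nN0.2|].
    exact/(gmap_wmap RS1 RS0).
  move=> i p; rewrite /jtype_refl /sigma_nu; case: eqP => _; last exact: tN0.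
  exact: Bga.
move=> Nv Nk [nNv nNk cNv gNk].
have GNk : G *m Nk = W Nv *m G by apply/(gmap_wmap RS1 RS0).
have [L hL] := cokernel_restrict hG kerG GNk.
(* The extension to [V]: the value at [k] is the restriction [L], nilpotent because [h] is
   injective. *)
pose N' := dfwith Nv L.
have N'k : N' k = L by apply: dfwith_in.
have N'i i : i != k -> N' i = Nv i by move=> ik; apply: dfwith_out; rewrite eq_sym.
(* No arrow ends at the source [k], so [W] does not see the value there. *)
have WN' : W N' = W Nv by apply: eq_bigr => a _; rewrite N'i // srck.
have nN' : nil_endo V N'.
  split=> [i|a].
    case: (eqVneq i k) => [->|ik]; last by rewrite N'i //; apply: nNv.
    rewrite N'k; apply: nilp_row_free hfree hL _; apply: (wmap_nilp RS1 RS0 SR1) => a _.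
    exact: nNv (srck a).
  case: (boolP (qsrc Q a == k)) => ak; last by rewrite !N'i //; apply: cNv.
  have : h *m W N' = N' k *m h by rewrite WN' N'k.
  by move=> /(hmap_wmap RS1 RS0)/(_ a ak).
move=> i; rewrite /jtype_refl /sigma_nu; case: (eqVneq i k) => [_|ik]; last first.
  by have := maxV _ nN' i; rewrite N'i.
have [u [v [eu ev uv nuv]]] := nil_endo_conj nN0 nN'.
pose N1 i := u i *m N0 i *m v i.
(* The line runs from [N1] at [s = 0], with the type of [N0] at [k], to [N'] at [s = 1], which
   induces [Nk] on the cokernel. *)
pose z s i := (1 - s) *: N1 i + s *: N' i.
have eN1 : is_endo V N1 by do 2!apply: is_endo_mul => //; exact: nN0.2.
have nz s : nil_endo V (z s).
  by split=> [j|]; [exact: nuv|apply: is_endo_lin => //; exact: nN'.2].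
have g1 : generic (fun s => forall J : 'I_M,
    \rank (mxpow (z 0%R k) J) <= \rank (mxpow (z s k) J))%N.
  apply: generic_all => J; apply: (generic_rank (f := fun s => mxpow (z s k) J)).
  exact/polymx_pow/polymx_line.
(* The ranks of the map induced on the cokernel are read through [cokernel_rank] from this matrix,
   which is polynomial in [s]. *)
have g2 : generic (fun s => forall J : 'I_M,
    \rank (col_mx (mxpow (W (z 1%R)) J) h) <= \rank (col_mx (mxpow (W (z s)) J) h))%N.
  apply: generic_all => J; apply: (generic_rank (f := fun s => col_mx (mxpow (W (z s)) J) h)).
  apply: polymx_col; last exact: polymx_const.
  apply: polymx_pow => a b; apply: polyc_ext (polymx_line (W N1) (W N') a b) => s.
  by rewrite /W wmap_lin.
have [s [rs1 rs2]] := generic_ex (generic_and g1 g2).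
have [B GB] := cokernel_induced hG Gfull kerG (hW _ (nz s).2).
apply: (dom_ga Nk (z s) B nNk (nz s) GB) => J; case: (ltnP J M) => JM.
- have := rs1 (Ordinal JM); rewrite /z /= subr0 scale1r scale0r addr0.
  apply: leq_trans; apply: eq_leq; symmetry.
  apply: (mxrank_mxpow_conj (P := u k)); first by have [] := mulmx1_unit (uv k).
  by rewrite /N1 -(mulmxA _ (v k)) (mulmx1C (uv k)) mulmx1.
- by rewrite nilp_mxpow_size ?mxrank0 //; [exact: nN0.1|lia].
- have Wz1 : W (z 1) = W Nv.
    rewrite -WN'; apply: eq_bigr => a _.
    by rewrite /z subrr scale0r scale1r add0r.
  have := rs2 (Ordinal JM); rewrite /= Wz1.
  rewrite -(cokernel_rank hG Gfull kerG J GNk) -(cokernel_rank hG Gfull kerG J GB).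
  by rewrite leq_add2r.
- by rewrite nilp_mxpow_size ?mxrank0 //; lia.
Qed.
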